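(* Let $E$ be a holomorphic vector bundle on $X$, and let $$\Theta\in H^0(X,\,\mathrm{End}(E)\otimes\mathcal{S}),\qquad \Theta'\in H^0(X,\,\mathrm{End}(E)\otimes\mathcal{L}).$$ Let $\varphi:Y\to X$ be the spectral curve of $(E,\Theta)$ and $F\subset\varphi^*E$ the associated sheaf. Then there is a $V$-twisted Higgs field $\theta$ on $E$ such that $\Theta=(\mathrm{Id}\otimes\widehat\rho_1)(\theta)$ and $\Theta'=(\mathrm{Id}\otimes\widehat\rho_2)(\theta)$ if and only if the following three statements hold: (1) The homomorphism $\varphi^*\Theta':\varphi^*E\to(\varphi^*E)\otimes\varphi^*\mathcal{L}$ sends the subsheaf $F$ into $F\otimes\varphi^*\mathcal{L}\subset(\varphi^*E)\otimes\varphi^*\mathcal{L}$. (2) The homomorphisms $(\varphi^*\Theta)|_F:F\to F\otimes\varphi^*\mathcal{S}$ and $(\varphi^*\Theta')|_F:F\to F\otimes\varphi^*\mathcal{L}$ commute, that is, $$\big((\varphi^*\Theta')|_F\otimes\mathrm{Id}_{\varphi^*\mathcal{S}}\big)\circ(\varphi^*\Theta)|_F=\big((\varphi^*\Theta)|_F\otimes\mathrm{Id}_{\varphi^*\mathcal{L}}\big)\circ(\varphi^*\Theta')|_F$$ as homomorphisms from $F$ to $F\otimes\varphi^*(\mathcal{S}\otimes\mathcal{L})$. (3) For every $x\in D$ and every connected component $y$ of $\varphi^{-1}(x)$, with $\Theta_y:F_y\to F_y\otimes\mathcal{S}_x$ and $\Theta'_y:F_y\to F_y\otimes\mathcal{L}_x$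 the homomorphisms induced by $\Theta(x)$ and $\Theta'(x)$, $$(\mathrm{Id}_{F_y}\otimes\xi_{1,x})\circ\Theta_y+(\mathrm{Id}_{F_y}\otimes\xi_{2,x})\circ\Theta'_y=0$$ as homomorphisms $F_y\to F_y\otimes\mathbb{T}_x$.
   Context: Setting. $X$ is a compact connected Riemann surface and $V$ is a holomorphic vector bundle of rank two on $X$. $\mathcal{S},\mathcal{L}$ are holomorphic line bundles on $X$, $D=\sum_{i=1}^{\ell}x_i$ is a reduced effective divisor (also regarded as a finite set of points), and there is a fixed short exact sequence of $\mathcal{O}_X$-modules $$0\to V\xrightarrow{\Phi}\mathcal{S}\oplus\mathcal{L}\xrightarrow{\xi}\mathbb{T}\to 0,$$ where $\mathbb{T}$ is a torsion sheaf with support $D$ and of length one at each point of $D$, such that for every $x\in D$ the induced maps $\xi_{1,x}:\mathcal{S}_x\to\mathbb{T}_x$ and $\xi_{2,x}:\mathcal{L}_x\to\mathbb{T}_x$ on fibers are injective (hence isomorphisms of one-dimensional spaces). Let $\widehat\rho_1:V\to\mathcal{S}$ and $\widehat\rho_2:V\to\mathcal{L}$ be the compositions of $\Phi$ with the two projections. Twisted Higgs fields. A $V$-twisted Higgs field on a holomorphic vector bundle $E$ is a section $\theta\in H^0(X,\mathrm{End}(E)\otimes V)$ with $\theta\wedge\theta=0$ in $H^0(X,\mathrm{End}(E)\otimes\bigwedge^2V)$ (locally, if $\theta=\sum_i A_i\otimes v_i$ then $\theta\wedge\theta=\sum_{i,j}A_iA_j\otimes v_i\wedge v_j$). For a line bundle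 $\mathcal{N}$, an $\mathcal{N}$-twisted Higgs field is a section of $\mathrm{End}(E)\otimes\mathcal{N}$, regarded also as a homomorphism $E\to E\otimes\mathcal{N}$. Spectral data. Given $\Theta\in H^0(X,\mathrm{End}(E)\otimes\mathcal{S})$ with $E$ of rank $r$, let $\phi:\mathcal{S}\to X$ be the projection from the total space of $\mathcal{S}$ and $t$ the tautological section of $\phi^*\mathcal{S}$. The spectral curve $Y\subset\mathcal{S}$ is the closed subscheme defined by the characteristic polynomial $t^r-\phi^*s_1t^{r-1}+\cdots+(-1)^r\phi^*s_r=0$, $s_i=\mathrm{tr}(\bigwedge^i\Theta)$, and $\varphi=\phi|_Y:Y\to X$. The associated sheaf is $F=\ker\big(\varphi^*\Theta-t\cdot\mathrm{Id}:\varphi^*E\to\varphi^*E\otimes\varphi^*\mathcal{S}\big)\subset\varphi^*E$, and it is preserved by $\varphi^*\Theta$. For $x\in X$ and a connected component $y$ of the scheme $\varphi^{-1}(x)$, $y_{\rm red}$ is a single point of the fiber $\mathcal{S}_x$, and it is an eigenvalue of $\Theta(x):E_x\to E_x\otimes\mathcal{S}_x$; $F_y\subset E_x$ denotes the generalized eigenspace of $\Theta(x)$ for the eigenvalue $y_{\rm red}$. It is preserved by $\Theta(x)$; when condition (1) holds, it is also preserved by $\Theta'(x)$ (i.e. $\Theta'(x)(F_y)\subset F_y\otimes\mathcal{L}_x$). *)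

(* Defs.v *)
From HB Require Import structures.
From mathcomp Require Import all_boot all_order all_algebra complex.
From mathcomp Require Import all_classical all_reals all_analysis.

Set Implicit Arguments.
Unset Strict Implicit.
Unset Printing Implicit Defensive.

Import Order.TTheory GRing.Theory Num.Theory.
Import numFieldNormedType.Exports.
Local Open Scope classical_set_scope.
Local Open Scope ring_scope.

Definition holo_near (R : realType) (W : normedModType R[i])
    (g : W -> R[i]^o) (w : W) : Prop :=
  \forall z \near w, differentiable g z.

(* Germs at x of functions and sections are represented by functions           *)
(* defined everywhere, of which only the values near x matter.  A predicate   *)
(* whose name ends in _at means holomorphy on some neighbourhood of the point *)
Record riemannSurface (R : realType) := RiemannSurface {
  rs_carrier :> topologicalType;
  rs_nonempty : [set: rs_carrier] !=set0;
  rs_hausdorff : hausdorff_space rs_carrier;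
  rs_compact : compact [set: rs_carrier];
  rs_connected : connected [set: rs_carrier];
  chart_idx : Type;
  chart_dom : chart_idx -> set rs_carrier;
  chart : chart_idx -> rs_carrier -> R[i]^o;
  chart_dom_open : forall a, open (chart_dom a);
  chart_cover : forall x, exists a, chart_dom a x;
  chart_inj : forall a, set_inj (chart_dom a) (chart a);
  chart_continuous : forall a x, chart_dom a x -> {for x, continuous (chart a)};
  chart_open : forall a (A : set rs_carrier),
    open A -> A `<=` chart_dom a -> open (chart a @` A);
  chart_transition : forall a b x, chart_dom a x -> chart_dom b x ->
    exists2 g : R[i]^o -> R[i]^o, holo_near g (chart a x) &
      \forall y \near x, chart b y = g (chart a y)
}.

Section Bundles.
Variables (R : realType) (X : riemannSurface R).
Local Notation C := (R[i]).

Definition hol_at (f : X -> C) (x : X) : Prop :=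
  forall a, chart_dom a x ->
    exists2 g : C^o -> C^o, holo_near g (chart a x) &
      \forall y \near x, f y = g (chart a y).

Definition hol_mx_at m n (A : X -> 'M[C]_(m, n)) (x : X) : Prop :=
  forall k l, hol_at (fun y => A y k l) x.

(* The fibre of a rank n bundle at every point is the vector space 'cV[C]_n,  *)
(* each fibre being identified with 'cV[C]_n by an arbitrary choice of basis  *)
(* made point by point.  The topology and the complex structure come only     *)
(* from the local trivialisations tr i, where tr i x is the linear            *)
(* isomorphism from the fibre at x to 'cV[C]_n.  In particular a section is   *)
(* not holomorphic when its entries are, but when its images under the        *)
(* trivialisations are.                                                       *)
Record bundle (n : nat) := Bundle {
  tr_idx : Type;
  tr_dom : tr_idx -> set X;
  tr : tr_idx -> X -> 'M[C]_n;
  tr_dom_open : forall i, open (tr_dom i);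
  tr_cover : forall x, exists i, tr_dom i x;
  tr_unit : forall i x, tr_dom i x -> tr i x \in unitmx;
  tr_transition : forall i j x, tr_dom i x -> tr_dom j x ->
    hol_mx_at (fun y => tr i y *m invmx (tr j y)) x
}.

Definition hol_section_at n (G : bundle n) (s : X -> 'cV[C]_n) (x : X) : Prop :=
  forall i : tr_idx G, tr_dom i x -> hol_mx_at (fun y => tr i y *m s y) x.

Definition hol_hom m n (G : bundle m) (H : bundle n)
    (A : X -> 'M[C]_(n, m)) : Prop :=
  forall x (i : tr_idx G) (j : tr_idx H), tr_dom i x -> tr_dom j x ->
    hol_mx_at (fun y => tr j y *m A y *m invmx (tr i y)) x.

Lemma hol_at_cst (c : C) x : hol_at (fun=> c) x.
Proof.
move=> a _; exists (cst c); first by near=> z; exact: differentiable_cst.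
by near=> y.
Unshelve. all: by end_near. Qed.

Lemma hol_atM (f g : X -> C) x :
  hol_at f x -> hol_at g x -> hol_at (fun y => f y * g y) x.
Proof.
move=> hf hg a ax; have [f' hf' ff'] := hf a ax; have [g' hg' gg'] := hg a ax.
exists (f' * g') => //.
  by apply: filterS2 hf' hg' => z ? ?; exact: differentiableM.
by apply: filterS2 ff' gg' => y -> ->.
Qed.

Section DirectSum.
Variables (m n : nat) (G : bundle m) (H : bundle n).

Let idx := (tr_idx G * tr_idx H)%type.
Let dom (p : idx) := tr_dom p.1 `&` tr_dom p.2.
Let t (p : idx) x := block_mx (tr p.1 x) 0 0 (tr p.2 x).

Let dom_open p : open (dom p).
Proof. by apply: openI; exact: tr_dom_open. Qed.

Let cover x : exists p, dom p x.
Proof.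
by have [i ix] := tr_cover G x; have [j jx] := tr_cover H x; exists (i, j).
Qed.

Let t_unit p x : dom p x -> t p x \in unitmx.
Proof. by case=> ? ?; rewrite /t unitmxE det_ublock unitrM -!unitmxE !tr_unit. Qed.

Let transition p q x : dom p x -> dom q x ->
  hol_mx_at (fun y => t p y *m invmx (t q y)) x.
Proof.
move=> [px1 px2] [qx1 qx2] k l a ax.
have near_q : \forall y \near x, dom q y by exact: open_nbhs_nbhs.
have E : \forall y \near x, (t p y *m invmx (t q y)) =
    block_mx (tr p.1 y *m invmx (tr q.1 y)) 0 0 (tr p.2 y *m invmx (tr q.2 y)).
  apply: filterS near_q => y qy; have qU := t_unit qy.
  rewrite /t invmx_block_diag // mulmx_block.
  by rewrite !mul0mx !mulmx0 !add0r !addr0.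
suff [g hg eg] : exists2 g : C^o -> C^o, holo_near g (chart a x) &
  \forall y \near x, block_mx (tr p.1 y *m invmx (tr q.1 y)) 0 0
    (tr p.2 y *m invmx (tr q.2 y)) k l = g (chart a y).
  by exists g => //; apply: filterS2 E eg => y ->.
have := tr_transition px1 qx1; have := tr_transition px2 qx2.
case: (split_ordP k) => k' ->; case: (split_ordP l) => l' -> h2 h1.
- have [g hg eg] := h1 k' l' a ax.
  by exists g => //; apply: filterS eg => y <-; rewrite block_mxEul.
- have [g hg eg] := hol_at_cst 0 (x := x) ax.
  by exists g => //; apply: filterS eg => y <-; rewrite block_mxEur mxE.
- have [g hg eg] := hol_at_cst 0 (x := x) ax.
  by exists g => //; apply: filterS eg => y <-; rewrite block_mxEdl mxE.
- have [g hg eg] := h2 k' l' a ax.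
  by exists g => //; apply: filterS eg => y <-; rewrite block_mxEdr.
Qed.

Definition dsum : bundle (m + n) := Bundle dom_open cover t_unit transition.
End DirectSum.

(* The tensor product of a rank n bundle E with a line bundle N.  Its fibre   *)
(* is again 'cV[C]_n, the element v (x) s of it being s ord0 ord0 *: v.       *)
Section Twist.
Variables (n : nat) (E : bundle n) (N : bundle 1).

Let idx := (tr_idx E * tr_idx N)%type.
Let dom (p : idx) := tr_dom p.1 `&` tr_dom p.2.
Let t (p : idx) x := tr p.2 x ord0 ord0 *: tr p.1 x.

Let dom_open p : open (dom p).
Proof. by apply: openI; exact: tr_dom_open. Qed.

Let cover x : exists p, dom p x.
Proof.
by have [i ix] := tr_cover E x; have [j jx] := tr_cover N x; exists (i, j).
Qed.

Let unit_line p x : dom p x -> tr p.2 x ord0 ord0 \is a GRing.unit.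
Proof. by case=> _ /tr_unit; rewrite unitmxE det_mx11. Qed.

Let t_unit p x : dom p x -> t p x \in unitmx.
Proof.
move=> px; rewrite /t unitmxE detZ unitrM unitrX ?unit_line //.
by rewrite -unitmxE tr_unit //; case: px.
Qed.

Let transition p q x : dom p x -> dom q x ->
  hol_mx_at (fun y => t p y *m invmx (t q y)) x.
Proof.
move=> [px1 px2] [qx1 qx2] k l a ax.
have near_q : \forall y \near x, dom q y by exact: open_nbhs_nbhs.
have [g hg eg] := hol_atM (tr_transition px2 qx2 ord0 ord0)
  (tr_transition px1 qx1 k l) ax.
exists g => //; apply: filterS2 near_q eg => y qy <-; have qU := t_unit qy.
have -> : (tr p.2 y *m invmx (tr q.2 y)) ord0 ord0 =
    tr p.2 y ord0 ord0 / tr q.2 y ord0 ord0.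
  have := congr1 (fun A : 'M[C]_1 => A ord0 ord0) (mulmxV (tr_unit qy.2)).
  rewrite !mxE !big_ord1 eqxx => e1; congr (_ * _).
  by apply: (mulrI (unit_line qy)); rewrite e1 mulrV ?unit_line.
by rewrite /t invmxZ // -scalemxAl -scalemxAr scalerA mxE.
Qed.

Definition twist : bundle n := Bundle dom_open cover t_unit transition.
End Twist.

(* An element of U (x) N_x, for N of rank n, is a family of n elements of U:  *)
(* its components in the standard basis of the fibre N_x = 'cV[C]_n.  Below   *)
(* U is the space 'M[C]_r of endomorphisms of a fibre E_x = 'cV[C]_r.         *)
Definition id_tensor r m n (B : 'M[C]_(n, m)) (T : 'I_m -> 'M[C]_r) :
    'I_n -> 'M[C]_r :=
  fun k => \sum_l B k l *: T l.

(* T is a holomorphic section of End(E) (x) N *)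
Definition hol_twisted_end r n (E : bundle r) (N : bundle n)
    (T : X -> 'I_n -> 'M[C]_r) : Prop :=
  forall x (i : tr_idx E) (j : tr_idx N), tr_dom i x -> tr_dom j x ->
    forall k, hol_mx_at (fun y =>
      id_tensor (tr j y) (fun l => tr i y *m T y l *m invmx (tr i y)) k) x.

(* e_i /\ e_j, as the alternating tensor e_i (x) e_j - e_j (x) e_i *)
Definition ext2_basis n (i j : 'I_n) : 'M[C]_n := delta_mx i j - delta_mx j i.

(* sum_(i, j) A_i A_j (x) (e_i /\ e_j); (k, l) is the index of a component    *)
(* in the square of the fibre of N, which contains its exterior square        *)
Definition wedge_square r n (A : 'I_n -> 'M[C]_r) (k l : 'I_n) : 'M[C]_r :=
  \sum_i \sum_j ext2_basis i j k l *: (A i *m A j).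

Definition twisted_higgs r n (E : bundle r) (V : bundle n)
    (th : X -> 'I_n -> 'M[C]_r) : Prop :=
  hol_twisted_end E V th /\ (forall x k l, wedge_square (th x) k l = 0).

(* The exact sequence 0 -> V -> S (+) L -> T -> 0.  A torsion sheaf with      *)
(* support D and of length one at each point of the finite set D is the sum   *)
(* of the skyscrapers at the x in D of one-dimensional spaces T_x, here       *)
(* 'cV[C]_1 by the choice of a basis; a homomorphism to it from S (+) L is    *)
(* given by linear maps xi x from the fibres at the points of D (the values   *)
(* of xi outside D are irrelevant).  Exactness is exactness of the sequence   *)
(* of germs at every point.                                                   *)
Record torsion_sequence (V : bundle 2) (S L : bundle 1) := TorsionSequence {
  ts_D : set X;
  ts_Phi : X -> 'M[C]_(1 + 1, 2);
  ts_xi : X -> 'M[C]_(1, 1 + 1);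
  ts_D_finite : finite_set ts_D;
  ts_Phi_hol : hol_hom V (dsum S L) ts_Phi;
  ts_xi1_inj : forall x, ts_D x ->
    injective (fun s : 'cV[C]_1 => lsubmx (ts_xi x) *m s);
  ts_xi2_inj : forall x, ts_D x ->
    injective (fun s : 'cV[C]_1 => rsubmx (ts_xi x) *m s);
  ts_exact_left : forall x v, hol_section_at V v x ->
    (\forall y \near x, ts_Phi y *m v y = 0) -> \forall y \near x, v y = 0;
  ts_exact_mid : forall x s, hol_section_at (dsum S L) s x ->
    (ts_D x -> ts_xi x *m s x = 0) <->
    (exists2 v, hol_section_at V v x & \forall y \near x, ts_Phi y *m v y = s y);
  ts_exact_right : forall x (tau : 'cV[C]_1), ts_D x ->
    exists2 s, hol_section_at (dsum S L) s x & ts_xi x *m s x = tau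
}.

Definition ts_rho1 V S L (Q : torsion_sequence V S L) x : 'M[C]_(1, 2) :=
  usubmx (ts_Phi Q x).
Definition ts_rho2 V S L (Q : torsion_sequence V S L) x : 'M[C]_(1, 2) :=
  dsubmx (ts_Phi Q x).
Definition ts_xi1 V S L (Q : torsion_sequence V S L) x : 'M[C]_1 :=
  lsubmx (ts_xi Q x).
Definition ts_xi2 V S L (Q : torsion_sequence V S L) x : 'M[C]_1 :=
  rsubmx (ts_xi Q x).

Section TotalSpace.
Variable S : bundle 1.

(* Points (x, s) of the total space of S, with s in the fibre S_x.  Its       *)
(* topology is NOT the product topology of this type: it is the one for which *)
(* (x, s) |-> (x, tot_coord j (x, s)) is a homeomorphism over tr_dom j.       *)
Definition tot : Type := (X * 'cV[C]_1)%type.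

Definition tot_coord (j : tr_idx S) (q : tot) : C :=
  (tr j q.1 *m q.2) ord0 ord0.

Definition tot_near (p : tot) (P : tot -> Prop) : Prop :=
  forall j : tr_idx S, tr_dom j p.1 ->
    \forall w \near (p.1, tot_coord j p : C^o),
      P (w.1, invmx (tr j w.1) *m const_mx w.2).

Definition tot_hol_at (f : tot -> C) (p : tot) : Prop :=
  forall a (j : tr_idx S), chart_dom a p.1 -> tr_dom j p.1 ->
    exists2 g : C^o * C^o -> C^o,
      holo_near g (chart a p.1, tot_coord j p : C^o) &
      tot_near p (fun q => f q = g (chart a q.1, tot_coord j q : C^o)).

(* germs of holomorphic sections of the pullback of G to the total space *)
Definition pull_section_at n (G : bundle n) (v : tot -> 'cV[C]_n) (p : tot) :=
  forall i : tr_idx G, tr_dom i p.1 ->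
    forall k, tot_hol_at (fun q => (tr i q.1 *m v q) k ord0) p.

Section Spectral.
Variables (r : nat) (E : bundle r) (Th : X -> 'I_1 -> 'M[C]_r).

Definition spectral_curve : set tot :=
  [set q : tot | root (char_poly (Th q.1 ord0)) (q.2 ord0 ord0)].

(* The equation of the spectral curve is a section of the pullback of the     *)
(* r-th power of S; this is the function it becomes in the trivialisation j.  *)
Definition spectral_eq (j : tr_idx S) (q : tot) : C :=
  (char_poly (tr j q.1 ord0 ord0 *: Th q.1 ord0)).[tot_coord j q].

(* The structure sheaf of the (possibly non-reduced) spectral curve is that   *)
(* of the total space modulo the ideal generated by spectral_eq, so a germ u  *)
(* at p of a section of the pullback of G to the total space is zero as a     *)
(* germ of section of the pullback of G to the curve when it lies in this     *)
(* ideal times the pullback of G.                                             *)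
Definition zero_on_curve n (G : bundle n) (u : tot -> 'cV[C]_n) (p : tot) :=
  forall j : tr_idx S, tr_dom j p.1 ->
    exists2 w, pull_section_at G w p &
      tot_near p (fun q => u q = spectral_eq j q *: w q).

(* Germs at p of sections of F: the kernel of Theta - t Id on the pullback of *)
(* E to the curve, where t is the tautological section q |-> q.2.             *)
Definition spectral_sheaf (v : tot -> 'cV[C]_r) (p : tot) : Prop :=
  pull_section_at E v p /\
  zero_on_curve (twist E S)
    (fun q => Th q.1 ord0 *m v q - q.2 ord0 ord0 *: v q) p.

(* Germs at p of the image of F (x) N in the pullback of E (x) N to the       *)
(* curve: finite sums of f (x) l, modulo the sections which vanish on it.     *)
Definition spectral_sheaf_twist (N : bundle 1) (u : tot -> 'cV[C]_r) (p : tot) :=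
  pull_section_at (twist E N) u p /\
  exists m (f : 'I_m -> tot -> 'cV[C]_r) (l : 'I_m -> tot -> 'cV[C]_1),
    (forall b, spectral_sheaf (f b) p /\ pull_section_at N (l b) p) /\
    zero_on_curve (twist E N)
      (fun q => u q - \sum_b l b q ord0 ord0 *: f b q) p.

End Spectral.
End TotalSpace.

(* v is in the generalised eigenspace of A for the eigenvalue a *)
Definition gen_eigen r (A : 'M[C]_r) (a : C) (v : 'cV[C]_r) : Prop :=
  exists m, (A - a%:M) ^+ m *m v = 0.

End Bundles.

(* Main.v *)
Require Import Defs.
From HB Require Import structures.
From mathcomp Require Import all_boot all_order all_algebra complex.
From mathcomp Require Import ring.
From mathcomp Require Import all_classical all_reals all_analysis.

Set Implicit Arguments.
Unset Strict Implicit.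
Unset Printing Implicit Defensive.

Import Order.TTheory GRing.Theory Num.Theory.
Import numFieldNormedType.Exports.
Local Open Scope classical_set_scope.
Local Open Scope ring_scope.

(** Both sides of the equivalence amount to one pointwise statement on X: Theta
    and Theta' commute, and xi_1 Theta + xi_2 Theta' vanishes on E_x for x in D.

    From theta to this statement.  Theta and Theta' are the two components of
    the image of theta under Phi, so their commutator is det Phi times the
    commutator of the components of theta ([id_tensor_commutator]), which is
    what theta /\ theta measures ([wedge_squareE]); and xi Phi = 0 over D
    ([ts_xi_Phi]).  Multiplied by a local frame of L, Theta' becomes an
    endomorphism of E commuting with Theta, so it preserves the kernel F of
    Theta - t ([spectral_sheaf_twist_commute]).

    From the conditions on F to this statement.  Let chi be the characteristic
    polynomial of Theta.  As (t - Theta) adj(t - Theta) = chi(t), the section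
    adj(t - Theta) e belongs to F for every local section e of E
    ([adjugate_section_spectral_sheaf]).  Commutation on F thus makes
    [Theta', Theta] adj(t - Theta) e a multiple of chi near every point of the
    curve.  In the fibre of S over a fixed x this concerns a polynomial in t of
    degree less than r whose quotient by chi stays continuous at every root of
    chi: such a polynomial is zero ([poly_eq0_of_local_quotients]).
    Multiplying by t - Theta leaves chi(t) [Theta', Theta] = 0, hence
    [Theta', Theta] = 0 ([commute_of_zero_on_curve]).  The condition over D is
    imposed on each generalised eigenspace of Theta(x), and these span E_x
    ([generalized_eigenvectors_span]).

    From this statement back to theta.  Exactness at S (+) L lifts the matrix
    entries of (Theta, Theta') through Phi near any given point
    ([local_lift]).  Outside the finite set D the map Phi is invertible, so
    that two local lifts agree there; the values at each x of a lift chosen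
    near x therefore coincide near x with one single holomorphic lift
    ([global_lift]).  Outside D the components of theta commute because det Phi
    is not zero, and at the points of D by continuity, a Riemann surface
    having no isolated point ([wedge_square_eq0]). *)

(** * Matrices over rings of functions *)

Section FunctionRing.
Variables (T : Type) (K : comNzRingType).

(** Germs of holomorphic functions on X and those on the total space of S form
    such rings; holomorphy of products, determinants and adjugates of matrices
    is derived once for both. *)
Definition function_ring (P : (T -> K) -> Prop) :=
  [/\ forall c, P (fun=> c),
      forall f g, P f -> P g -> P (fun t => f t + g t) &
      forall f g, P f -> P g -> P (fun t => f t * g t)].

Definition entrywise m n (P : (T -> K) -> Prop) (A : T -> 'M[K]_(m, n)) :=
  forall k l, P (fun t => A t k l).

Variables (P : (T -> K) -> Prop) (ringP : function_ring P).

Lemma function_ring_sum (I : finType) (Q : pred I) (F : I -> T -> K) :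
  (forall i, Q i -> P (F i)) -> P (fun t => \sum_(i | Q i) F i t).
Proof.
case: ringP => P1 PD _ PF.
rewrite (_ : (fun t => _) = \big[(fun f g t => f t + g t)/(fun=> 0)]_(i | Q i) F i).
  by elim/big_rec: _ => [//|i f Qi Pf]; exact: PD (PF i Qi) Pf.
by apply/funext => t; rewrite (big_morph (@^~ t) (op1 := +%R) (id1 := 0)).
Qed.

Lemma function_ring_prod (I : finType) (Q : pred I) (F : I -> T -> K) :
  (forall i, Q i -> P (F i)) -> P (fun t => \prod_(i | Q i) F i t).
Proof.
case: ringP => P1 _ PM PF.
rewrite (_ : (fun t => _) = \big[(fun f g t => f t * g t)/(fun=> 1)]_(i | Q i) F i).
  by elim/big_rec: _ => [//|i f Qi Pf]; exact: PM (PF i Qi) Pf.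
by apply/funext => t; rewrite (big_morph (@^~ t) (op1 := *%R) (id1 := 1)).
Qed.

Lemma function_ringN f : P f -> P (fun t => - f t).
Proof.
case: ringP => P1 _ PM Pf.
rewrite (_ : (fun t => _) = (fun t => -1 * f t)); first exact: PM.
by apply/funext => t; rewrite mulN1r.
Qed.

Lemma entrywiseD m n (A B : T -> 'M[K]_(m, n)) :
  entrywise P A -> entrywise P B -> entrywise P (fun t => A t + B t).
Proof.
case: ringP => _ PD _ PA PB k l.
rewrite (_ : (fun t => _) = (fun t => A t k l + B t k l)); first exact: PD.
by apply/funext => t; rewrite mxE.
Qed.

Lemma entrywiseN m n (A : T -> 'M[K]_(m, n)) :
  entrywise P A -> entrywise P (fun t => - A t).
Proof.
move=> PA k l; rewrite (_ : (fun t => _) = (fun t => - A t k l)).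
  exact: function_ringN.
by apply/funext => t; rewrite mxE.
Qed.

Lemma entrywiseZ m n (f : T -> K) (A : T -> 'M[K]_(m, n)) :
  P f -> entrywise P A -> entrywise P (fun t => f t *: A t).
Proof.
case: ringP => _ _ PM Pf PA k l.
rewrite (_ : (fun t => _) = (fun t => f t * A t k l)); first exact: PM.
by apply/funext => t; rewrite mxE.
Qed.

Lemma entrywiseM m n p (A : T -> 'M[K]_(m, n)) (B : T -> 'M[K]_(n, p)) :
  entrywise P A -> entrywise P B -> entrywise P (fun t => A t *m B t).
Proof.
case: ringP => _ _ PM PA PB k l.
rewrite (_ : (fun t => _) = (fun t => \sum_j A t k j * B t j l)).
  by apply: function_ring_sum => j _; exact: PM.
by apply/funext => t; rewrite mxE.
Qed.

Lemma entrywise_cst m n (A : 'M[K]_(m, n)) : entrywise P (fun=> A).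
Proof. by case: ringP => P1 _ _ k l. Qed.

Lemma entrywise_scalar n f : P f -> entrywise P (fun t => (f t)%:M : 'M[K]_n).
Proof.
move=> Pf; rewrite (_ : (fun t => _) = (fun t => f t *: (1%:M : 'M[K]_n))).
  exact/entrywiseZ/entrywise_cst.
by apply/funext => t; rewrite scale_scalar_mx mulr1.
Qed.

Lemma entrywise_det n (A : T -> 'M[K]_n) :
  entrywise P A -> P (fun t => \det (A t)).
Proof.
case: ringP => P1 _ PM PA; apply: function_ring_sum => s _; apply: PM => //.
exact: function_ring_prod.
Qed.

Lemma entrywise_adj n (A : T -> 'M[K]_n) :
  entrywise P A -> entrywise P (fun t => \adj (A t)).
Proof.
case: ringP => P1 _ PM PA k l.
rewrite (_ : (fun t => _) = (fun t => cofactor (A t) l k)); last first.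
  by apply/funext => t; rewrite mxE.
apply: PM => //; apply: entrywise_det => a b.
rewrite (_ : (fun t => _) = (fun t => A t (lift l a) (lift k b))) //.
by apply/funext => t; rewrite !mxE.
Qed.

End FunctionRing.

(** * The adjugate of the characteristic matrix *)

Section CharacteristicMatrix.

Lemma horner_char_poly (K : comNzRingType) n (B : 'M[K]_n) (t : K) :
  (char_poly B).[t] = \det (t%:M - B).
Proof.
rewrite /char_poly -[LHS]/(horner_eval t _) -det_map_mx; congr (\det _).
apply/matrixP => i j; rewrite !mxE rmorphB rmorphMn /= /horner_eval.
by rewrite hornerX hornerC.
Qed.

Lemma horner_adj_char_poly_mx (K : comNzRingType) n (B : 'M[K]_n) (t : K) k l :
  (\adj (char_poly_mx B) k l).[t] = \adj (t%:M - B) k l.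
Proof.
rewrite -[LHS]/(horner_eval t _).
have -> : t%:M - B = map_mx (horner_eval t) (char_poly_mx B).
  apply/matrixP => i j; rewrite !mxE rmorphB rmorphMn /= /horner_eval.
  by rewrite hornerX hornerC.
by rewrite -map_mx_adj [RHS]mxE.
Qed.

Lemma size_prod_linear (K : comNzRingType) n (f : 'I_n -> {poly K}) :
  (forall i, (size (f i) <= 2)%N) -> (size (\prod_i f i)%R <= n.+1)%N.
Proof.
move=> sf; apply: (leq_trans (size_poly_prod_leq _ _)).
have -> : (n.+1 = (\sum_(i < n) 2).+1 - #|'I_n|)%N.
  by rewrite sum_nat_const card_ord muln2 -addnn -addSn addnK.
by apply: leq_sub2r; rewrite ltnS; apply: leq_sum.
Qed.

Lemma size_det_linear (K : comNzRingType) n (A : 'M[{poly K}]_n) :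
  (forall i j, (size (A i j) <= 2)%N) -> (size (\det A) <= n.+1)%N.
Proof.
move=> sA; apply: (leq_trans (size_sum _ _ _)); apply/bigmax_leqP => s _.
by rewrite mulr_sign; case: ifP => _; rewrite ?size_polyN size_prod_linear.
Qed.

(** The entries of adj(X - B) are minors of size n - 1 of a matrix with entries
    of degree at most one.  This strict drop below the degree n of the
    characteristic polynomial is what forces a multiple of the latter to
    vanish. *)
Lemma size_adj_char_poly_mx (K : comNzRingType) n (B : 'M[K]_n) k l :
  (size (\adj (char_poly_mx B) k l) <= n)%N.
Proof.
rewrite mxE /cofactor -signr_odd mulr_sign.
have n_gt0 : (0 < n)%N by apply: leq_ltn_trans (ltn_ord k).
have H : (size (\det (row' l (col' k (char_poly_mx B)))) <= n)%N.
  rewrite -[leqRHS](prednK n_gt0); apply: size_det_linear => i j; rewrite !mxE.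
  case: eqP => _; last by rewrite mulr0n sub0r size_polyN (leq_trans (size_polyC_leq1 _)).
  by rewrite mulr1n size_XsubC.
by case: ifP => _; rewrite ?size_polyN.
Qed.

(** Multiplying by X - B on the right turns M adj(X - B) into chi_B M, and
    chi_B is monic. *)
Lemma mul_adj_char_poly_mx_eq0 (K : idomainType) m n (M : 'M[K]_(m, n)) (B : 'M[K]_n) :
  map_mx polyC M *m \adj (char_poly_mx B) = 0 -> M = 0.
Proof.
move=> /(congr1 (mulmx^~ (char_poly_mx B))).
rewrite -mulmxA mul_adj_mx mul0mx mul_mx_scalar => M0.
apply/matrixP => i j.
have /eqP := congr1 (fun A : 'M[{poly K}]_(m, n) => A i j) M0.
rewrite !mxE mulf_eq0 -/(char_poly B) (negPf (monic_neq0 (char_poly_monic B))).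
by rewrite polyC_eq0 => /eqP.
Qed.
End CharacteristicMatrix.

(** * Polynomials and generalised eigenspaces over the complex numbers *)

Lemma near_neq (T : topologicalType) (a b : T) : hausdorff_space T ->
  b != a -> \forall t \near b, t != a.
Proof.
move=> /hausdorff_accessible accT /accT [U [oU bU aU]].
have : nbhs b U by apply: open_nbhs_nbhs; split => //; exact: set_mem.
by apply: filterS => t Ut; apply/eqP => ta; move: aU; rewrite inE; apply; rewrite -ta.
Qed.

Section OneVariable.
Variable R : realType.
Local Notation C := (R[i]).

Lemma continuous_horner_complex (p : {poly C}) :
  continuous ((fun t => p.[t]) : C^o -> C^o).
Proof.
elim/poly_ind: p => [|p c IH] t.
  rewrite (_ : (fun t => _) = cst 0); first exact: cst_continuous.
  by apply/funext => u; rewrite horner0.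
rewrite (_ : (fun t => _) = (fun t : C^o => (p.[t] : C^o) * t + c)).
  have ct := @continuousM C C^o _ _ _ (IH t) (@cvg_id _ _).
  exact: (@cvgD C C^o _ _ _ _ _ _ _ ct (@cvg_cst C^o c _ _ _)).
by apply/funext => u; rewrite hornerMXaddC.
Qed.

(** No point of C is isolated, so a continuous function is determined at a point
    by its values around it. *)
Lemma cvg_dnbhs_eq (f g : C^o -> C^o) (a : C^o) :
  {for a, continuous f} -> {for a, continuous g} ->
  (\forall t \near a^', f t = g t) -> f a = g a.
Proof.
move=> /continuous_withinNx fa /continuous_withinNx ga fg.
have ga' : f t @[t --> a^'] --> g a.
  by apply: cvg_trans ga; apply: near_eq_cvg; near do symmetry.
exact: (cvg_unique _ fa ga').
Unshelve. all: by end_near. Qed.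

(** If p is nonzero, then, its degree being smaller, some root of q
    has a larger multiplicity in q than in p, and there p / q is unbounded.
    The quotient is only compared with w on punctured neighbourhoods so that a
    common linear factor can be cancelled, which is the step of the induction
    on the degree of q. *)
Lemma poly_eq0_of_local_quotients (p q : {poly C}) : (size p < size q)%N ->
  (forall a : C^o, root q a -> exists2 w : C^o -> C^o, {for a, continuous w} &
     \forall t \near a^', p.[t] = q.[t] * w t) -> p = 0.
Proof.
have [n] := ubnP (size q); elim: n p q => // n IH p q; rewrite ltnS => sq spq.
move=> pq; have [sq1|sq1] := leqP (size q) 1.
  by apply/eqP; rewrite -size_poly_eq0 -leqn0 -ltnS (leq_trans spq).
have [a qa] : exists a, root q a by apply/closed_rootP; rewrite neq_ltn sq1 orbT.
have /factor_theorem [q' q'E] := qa.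
have /factor_theorem [p' p'E] : root p a.
  have [w wa pqw] := pq _ qa; rewrite /root.
  have /= -> := cvg_dnbhs_eq (@continuous_horner_complex p a)
    (@continuousM C _ _ _ _ (@continuous_horner_complex q a) wa) pqw.
  by rewrite (rootP qa) mul0r.
have q'0 : q' != 0 by apply: contraTneq sq1 => q0; rewrite q'E q0 mul0r size_poly0.
suff p'0 : p' = 0 by rewrite p'E p'0 mul0r.
have sqE : size q = (size q').+1.
  by rewrite q'E size_Mmonic ?monicXsubC // size_XsubC addn2.
apply: (IH p' q').
- by rewrite -ltnS -sqE.
- have [->|p'0] := eqVneq p' 0; first by rewrite size_poly0 lt0n size_poly_eq0.
  by move: spq; rewrite sqE p'E size_Mmonic ?monicXsubC // size_XsubC addn2.
- move=> b q'b; have [|w wb pqw] := pq b; first by rewrite q'E rootM q'b.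
  exists w => //.
  have ba : \forall t \near b^', t != a.
    have [->|ba] := eqVneq b a; first exact: nbhs_dnbhs_neq.
    have := @near_neq C^o a b (@norm_hausdorff _ C^o) ba.
    exact: nbhs_dnbhs.
  apply: filterS2 pqw ba => t; rewrite p'E q'E !hornerM hornerXsubC => E ta.
  by apply: (mulIf (_ : t - a != 0)); rewrite ?subr_eq0 // E mulrAC.
Qed.

End OneVariable.

(** If the polynomial p(A) kills v and p = (X - a)^k q with q(a) nonzero, a
    Bezout relation splits v into a part killed by (A - a)^k and a part killed
    by q(A); induction on the degree then starts from the Cayley-Hamilton
    theorem. *)
Lemma generalized_eigenvectors_span (R : realType) m r (A : 'M[R[i]]_r)
    (N : 'M[R[i]]_(m, r)) :
  (forall a v, root (char_poly A) a -> gen_eigen A a v -> N *m v = 0) -> N = 0.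
Proof.
case: r A N => [|r] A N NA; first by rewrite [N]thinmx0.
suff H (p : {poly R[i]}) (v : 'cV_r.+1) : p != 0 ->
    (forall a, root p a -> root (char_poly A) a) ->
    horner_mx A p *m v = 0 -> N *m v = 0.
  apply/matrixP => i j; have := H (char_poly A) (delta_mx j ord0).
  rewrite monic_neq0 ?char_poly_monic // Cayley_Hamilton mul0mx.
  move=> /(_ isT (fun _ => id) erefl); rewrite -colE.
  by move=> /matrixP /(_ i ord0); rewrite !mxE.
have [n] := ubnP (size p); elim: n p v => // n IH p v; rewrite ltnS => sp p0 pA pv.
have [sp1|sp1] := boolP (size p == 1).
  have /size_poly1P[c c0 pE] := sp1.
  move: pv; rewrite pE horner_mx_C mul_scalar_mx => /eqP.
  by rewrite scalemx_eq0 (negPf c0) => /eqP ->; rewrite mulmx0.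
have /closed_rootP[a pa] := sp1.
have [k [q qa pE]] := multiplicity_XsubC p a.
rewrite p0 /= in qa.
have k0 : (0 < k)%N.
  rewrite lt0n; apply: contraNneq qa => k0.
  by rewrite -[q]mulr1 -(expr0 ('X - a%:P)) -k0 -pE.
have q0 : q != 0 by apply: contraNneq p0 => q0; rewrite pE q0 mul0r.
have /Bezout_eq1_coprimepP[[u1 u2] /= uE] : coprimep (('X - a%:P) ^+ k) q.
  by apply: coprimep_expl; rewrite coprimep_sym coprimep_XsubC.
have -> : v = horner_mx A (u1 * ('X - a%:P) ^+ k) *m v + horner_mx A (u2 * q) *m v.
  by rewrite -mulmxDl -rmorphD uE rmorph1 mul1mx.
rewrite mulmxDr (IH q) ?add0r //.
- apply: (NA a); first exact: pA.
  exists k; rewrite mulmxA.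
  have -> : (A - a%:M) ^+ k = horner_mx A (('X - a%:P) ^+ k).
    by rewrite rmorphXn rmorphB /= horner_mx_X horner_mx_C.
  rewrite mulmxE -rmorphM /= mulrCA -[_ * q]mulrC -pE rmorphM -mulmxE -mulmxA.
  by rewrite pv mulmx0.
- apply: leq_trans sp; rewrite pE size_Mmonic ?monic_exp ?monicXsubC //.
  by rewrite size_exp_XsubC addnS /= -[ltnLHS]addn0 ltn_add2l.
- by move=> b qb; apply: pA; rewrite pE rootM qb.
- rewrite mulmxA mulmxE -rmorphM /= mulrCA -pE rmorphM -mulmxE -mulmxA.
  by rewrite pv mulmx0.
Qed.

(** * Holomorphic germs on the surface and on the total space of a line bundle *)

Lemma near_fst (T U : topologicalType) (a : T) (b : U) (P : T -> Prop) :
  (\forall x \near a, P x) -> \forall z \near (a, b), P z.1.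
Proof. by apply: (cvg_fst (G := nbhs b)). Qed.

Lemma continuous_slice (T U : topologicalType) (a : T) (b : U) :
  {for b, continuous (fun t => (a, t))}.
Proof. exact: (cvg_pair (cvg_cst a) cvg_id). Qed.

Lemma differentiable_comp_fst (R : realType) (g : R[i]^o -> R[i]^o)
    (z : R[i]^o * R[i]^o) :
  differentiable g z.1 -> differentiable (fun z : R[i]^o * R[i]^o => g z.1) z.
Proof.
move=> gz; apply: differentiable_comp gz.
by apply: linear_differentiable => ?; exact: cvg_fst.
Qed.

Section HolomorphicGerms.
Variables (R : realType) (X : riemannSurface R).
Local Notation C := (R[i]).

Lemma hol_at_near_eq (f g : X -> C) x :
  (\forall y \near x, f y = g y) -> hol_at f x -> hol_at g x.
Proof.
move=> fg hf a ax; have [h hh fh] := hf a ax; exists h => //.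
by apply: filterS2 fg fh => y ->.
Qed.

Lemma hol_at_ring x : function_ring (fun f : X -> C => hol_at f x).
Proof.
split => [c|f g hf hg|]; [exact: hol_at_cst| |by move=> f g; exact: hol_atM].
move=> a ax; have [f' hf' ff'] := hf a ax; have [g' hg' gg'] := hg a ax.
exists (f' + g').
  by apply: filterS2 hf' hg' => z ? ?; exact: differentiableD.
by apply: filterS2 ff' gg' => y -> ->.
Qed.

Lemma hol_at_continuous (f : X -> C^o) x : hol_at f x -> {for x, continuous f}.
Proof.
move=> hf; have [a ax] := chart_cover x; have [g hg fg] := hf a ax.
have fgx : f x = g (chart a x) by exact: (nbhs_singleton fg).
have gc : {for chart a x, continuous g}.
  exact/differentiable_continuous/(nbhs_singleton hg).
have cc := chart_continuous ax.
have gx : {for x, continuous (g \o chart a)} := continuous_comp cc gc.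
have E : (fun y => f y) @ x --> (g \o chart a) x.
  apply: cvg_trans gx.
  by apply: near_eq_cvg; near do symmetry.
by rewrite /= -fgx in E.
Unshelve. all: by end_near. Qed.

(** A chart would map an isolated point to an open singleton of C. *)
Lemma not_open_set1 (x : X) : ~ open [set x].
Proof.
have [a ax] := chart_cover x => ox.
have : open (chart a @` [set x]) by apply: chart_open => // _ ->.
rewrite image_set1 => oc.
have nc : nbhs (chart a x) [set chart a x] by exact: open_nbhs_nbhs.
have [z [zc]] : exists z : C^o, z != chart a x /\ z = chart a x.
  apply: (@filter_ex _ _ (Proper_dnbhs_regular_numFieldType (chart a x))).
  by apply: filterS2 (nbhs_dnbhs_neq _) (nbhs_dnbhs nc) => z.
by move=> zE; rewrite zE eqxx in zc.
Qed.

(** By continuity, x not being isolated; this extends to D relations which are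
    clear outside D. *)
Lemma hol_at_dnbhs_eq0 (f : X -> C) x :
  hol_at f x -> (\forall y \near x^', f y = 0) -> f x = 0.
Proof.
move=> /hol_at_continuous fc f0; apply: contrapT => fx0.
apply: (@not_open_set1 x).
have fn0 : \forall y \near x, f y != 0.
  have /fc := @near_neq C^o 0 (f x) (@norm_hausdorff _ C^o) (introN eqP fx0).
  exact.
have f0' : \forall y \near x, y != x -> f y = 0 by exact: f0.
rewrite openE => _ ->; change (nbhs x [set x]).
apply: filterS2 f0' fn0 => y; case: (eqVneq y x) => [//|yx ->] //.
by rewrite eqxx.
Qed.

Section TotalSpace.
Variable S : bundle X 1.
Local Notation tot := (tot X).
Implicit Types (p : tot) (P : tot -> Prop).

Lemma tot_nearE p P : (forall q, P q) -> tot_near S p P.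
Proof. by move=> PP j jp; apply: filterE => w; exact: PP. Qed.

Lemma tot_nearS p P Q : (forall q, P q -> Q q) ->
  tot_near S p P -> tot_near S p Q.
Proof. by move=> PQ hP j jp; apply: filterS (hP j jp) => w; exact: PQ. Qed.

Lemma tot_nearS2 p P P' Q : (forall q, P q -> P' q -> Q q) ->
  tot_near S p P -> tot_near S p P' -> tot_near S p Q.
Proof.
by move=> PQ hP hP' j jp; apply: filterS2 (hP j jp) (hP' j jp) => w; exact: PQ.
Qed.

Lemma tot_near_base p (P : X -> Prop) :
  (\forall y \near p.1, P y) -> tot_near S p (fun q => P q.1).
Proof. by move=> Pp j jp; exact: near_fst. Qed.

Lemma tot_near_tr_dom n (G : bundle X n) p (i : tr_idx G) :
  tr_dom i p.1 -> tot_near S p (fun q => tr_dom i q.1).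
Proof.
by move=> ip; apply: tot_near_base; apply: open_nbhs_nbhs; split=> //; exact: tr_dom_open.
Qed.

Lemma tot_coord_fiber (j : tr_idx S) x t : tr_dom j x ->
  tot_coord j (x, invmx (tr j x) *m const_mx t) = t.
Proof. by move=> jx; rewrite /tot_coord mulKVmx ?tr_unit // mxE. Qed.

Lemma tot_hol_at_near_eq (f g : tot -> C) p :
  tot_near S p (fun q => f q = g q) -> tot_hol_at S f p -> tot_hol_at S g p.
Proof.
move=> fg hf a j ap jp; have [h hh fh] := hf a j ap jp; exists h => //.
by apply: tot_nearS2 fg fh => q ->.
Qed.

Lemma tot_hol_at_ring p : function_ring (fun f : tot -> C => tot_hol_at S f p).
Proof.
split => [c|f g hf hg|f g hf hg] a j ap jp.
- exists (cst c); first by near=> z; exact: differentiable_cst.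
  exact: tot_nearE.
- have [f' hf' ff'] := hf a j ap jp; have [g' hg' gg'] := hg a j ap jp.
  exists (f' + g').
    by apply: filterS2 hf' hg' => z ? ?; exact: differentiableD.
  by apply: tot_nearS2 ff' gg' => y -> ->.
- have [f' hf' ff'] := hf a j ap jp; have [g' hg' gg'] := hg a j ap jp.
  exists (f' * g').
    by apply: filterS2 hf' hg' => z ? ?; exact: differentiableM.
  by apply: tot_nearS2 ff' gg' => y -> ->.
Unshelve. all: by end_near. Qed.

Lemma tot_hol_at_base (f : X -> C) p : hol_at f p.1 ->
  tot_hol_at S (fun q => f q.1) p.
Proof.
move=> hf a j ap jp; have [g hg fg] := hf a ap.
exists (g \o fst).
  have : \forall z \near (chart a p.1 : C^o, tot_coord j p : C^o), differentiable g z.1.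
    exact: (@near_fst C^o C^o _ _ (fun z => differentiable g z) hg).
  by apply: filterS => z; exact: differentiable_comp_fst.
by apply: tot_nearS (tot_near_base fg) => q ->.
Qed.

(** In the trivialisation j the function is the transition function from j to
    j0 times the fibre coordinate. *)
Lemma tot_hol_at_coord (j0 : tr_idx S) p : tr_dom j0 p.1 ->
  tot_hol_at S (tot_coord j0) p.
Proof.
move=> j0p a j ap jp; have [g hg fg] := tr_transition j0p jp ord0 ord0 ap.
exists (fun z => g z.1 * z.2).
  have : \forall z \near (chart a p.1 : C^o, tot_coord j p : C^o), differentiable g z.1.
    exact: (@near_fst C^o C^o _ _ (fun z => differentiable g z) hg).
  apply: filterS => z gz; apply: differentiableM.
    exact: differentiable_comp_fst.
  have : differentiable (@snd C^o C^o) z.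
    by apply: linear_differentiable => ?; exact: cvg_snd.
  exact.
apply: tot_nearS2 (tot_near_base fg) (tot_near_tr_dom jp) => q gq jq /=.
rewrite -gq /tot_coord.
rewrite -{1}(mulmxKV (tr_unit jq) (tr j0 q.1)) -(mulmxA _ _ q.2).
by rewrite [LHS]mxE big_ord1.
Qed.

(** Statements near a point of the total space are restricted to the fibre,
    where the coordinate of S is the only variable left. *)
Lemma tot_near_fiber p P (j : tr_idx S) : tr_dom j p.1 -> tot_near S p P ->
  \forall t \near (tot_coord j p : C^o), P (p.1, invmx (tr j p.1) *m const_mx t).
Proof.
move=> jp /(_ j jp) Pp.
exact: continuous_slice Pp.
Qed.

Lemma tot_hol_at_fiber (f : tot -> C) p (j : tr_idx S) : tr_dom j p.1 ->
  tot_hol_at S f p ->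
  exists2 w : C^o -> C^o, {for (tot_coord j p : C^o), continuous w} &
    \forall t \near (tot_coord j p : C^o),
      f (p.1, invmx (tr j p.1) *m const_mx t) = w t.
Proof.
move=> jp hf; have [a ap] := chart_cover p.1; have [g hg fg] := hf a j ap jp.
exists (fun t => g (chart a p.1, t)).
  have gc : {for (chart a p.1, tot_coord j p : C^o), continuous g}.
    exact/differentiable_continuous/(nbhs_singleton hg).
  have uc : {for (tot_coord j p : C^o), continuous
      (fun t : C^o => (chart a p.1 : C^o, t))}.
    exact: (@continuous_slice C^o C^o).
  exact: (continuous_comp uc gc).
by apply: filterS (tot_near_fiber jp fg) => t ->; rewrite tot_coord_fiber.
Qed.

End TotalSpace.
End HolomorphicGerms.

(** * Endomorphisms twisted by a vector space of dimension two *)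

Section TwoByTwo.

Lemma sum_ord2 (M : nmodType) (F : 'I_2 -> M) : \sum_i F i = F 0 + F 1.
Proof. by rewrite !big_ord_recl big_ord0 addr0; congr (_ + F _); exact: val_inj. Qed.

Variable K : comNzRingType.

Lemma det_mx22 (B : 'M[K]_2) : \det B = B 0 0 * B 1 1 - B 0 1 * B 1 0.
Proof.
rewrite (expand_det_row _ 0) sum_ord2 /cofactor !det_mx11 !mxE.
rewrite /= !addn0 !add0n expr0 expr1 mul1r mulN1r mulrN.
by congr (B _ _ * B _ _ - B _ _ * B _ _); exact: val_inj.
Qed.

Lemma lin_comb_commutator r (a b c d : K) (A B : 'M[K]_r) :
  (a *: A + b *: B) *m (c *: A + d *: B) - (c *: A + d *: B) *m (a *: A + b *: B)
  = (a * d - b * c) *: (A *m B - B *m A).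
Proof.
rewrite !mulmxDl !mulmxDr -!scalemxAl -!scalemxAr !scalerA.
set x := A *m B; set y := B *m A; set z := A *m A; set t := B *m B.
by apply/matrixP => i j; rewrite !mxE; ring.
Qed.

End TwoByTwo.

Section Tensor.
Variable R : realType.
Local Notation C := (R[i]).

Lemma id_tensorM r m n p (A : 'M[C]_(p, n)) (B : 'M[C]_(n, m)) (T : 'I_m -> 'M[C]_r) :
  id_tensor (A *m B) T = id_tensor A (id_tensor B T).
Proof.
apply/funext => k; rewrite /id_tensor.
under eq_bigr => l _ do rewrite mxE scaler_suml.
rewrite exchange_big /=; apply: eq_bigr => j _.
by rewrite scaler_sumr; apply: eq_bigr => l _; rewrite scalerA.
Qed.

Lemma id_tensor1 r m (T : 'I_m -> 'M[C]_r) : id_tensor 1%:M T = T.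
Proof.
apply/funext => k; rewrite /id_tensor (bigD1 k) //= mxE eqxx scale1r big1 ?addr0 //.
by move=> l lk; rewrite mxE eq_sym (negPf lk) scale0r.
Qed.

Lemma id_tensor_conj r m n (B : 'M[C]_(n, m)) (P Q : 'M[C]_r) T k :
  id_tensor B (fun l => P *m T l *m Q) k = P *m id_tensor B T k *m Q.
Proof.
rewrite /id_tensor mulmx_sumr mulmx_suml; apply: eq_bigr => l _.
by rewrite -scalemxAr -scalemxAl.
Qed.

Lemma id_tensor_line r (B : 'M[C]_1) (T : 'I_1 -> 'M[C]_r) k :
  id_tensor B T k = B ord0 ord0 *: T ord0.
Proof. by rewrite /id_tensor big_ord1 (ord1 k). Qed.

(** Applied to B = Phi it compares the commutator of Theta and Theta' with
    theta /\ theta; applied to a trivialisation of V it shows that the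
    vanishing of theta /\ theta does not depend on a frame. *)
Lemma id_tensor_commutator r (B : 'M[C]_2) (T : 'I_2 -> 'M[C]_r) :
  id_tensor B T 0 *m id_tensor B T 1 - id_tensor B T 1 *m id_tensor B T 0 =
  \det B *: (T 0 *m T 1 - T 1 *m T 0).
Proof. by rewrite /id_tensor !sum_ord2 det_mx22 lin_comb_commutator. Qed.

(** The exterior square of a rank two fibre is a line, so that theta /\ theta
    has a single coefficient. *)
Lemma wedge_squareE r (T : 'I_2 -> 'M[C]_r) k l :
  wedge_square T k l = ext2_basis R 0 1 k l *: (T 0 *m T 1 - T 1 *m T 0).
Proof.
have diag i : ext2_basis R i i k l = 0 by rewrite /ext2_basis subrr mxE.
have anti : ext2_basis R 1 0 k l = - ext2_basis R 0 1 k l.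
  by rewrite /ext2_basis -opprB mxE.
rewrite /wedge_square !sum_ord2 !diag anti !scale0r add0r addr0.
by rewrite scaleNr scalerBr.
Qed.

Lemma usubmx_id_tensor r n (B : 'M[C]_(1 + 1, n)) (T : 'I_n -> 'M[C]_r) k :
  id_tensor (usubmx B) T k = id_tensor B T 0.
Proof.
rewrite /id_tensor; apply: eq_bigr => l _; rewrite mxE; congr (B _ _ *: _).
by apply: val_inj; rewrite (ord1 k).
Qed.

Lemma dsubmx_id_tensor r n (B : 'M[C]_(1 + 1, n)) (T : 'I_n -> 'M[C]_r) k :
  id_tensor (dsubmx B) T k = id_tensor B T 1.
Proof.
rewrite /id_tensor; apply: eq_bigr => l _; rewrite mxE; congr (B _ _ *: _).
by apply: val_inj; rewrite (ord1 k).
Qed.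

Lemma tensor_pairP r (T U : 'I_2 -> 'M[C]_r) : T 0 = U 0 -> T 1 = U 1 -> T = U.
Proof.
move=> h0 h1; apply/funext => k.
case: k => [[|[|//]] kP].
- by rewrite (_ : Ordinal kP = 0); last exact: val_inj.
- by rewrite (_ : Ordinal kP = 1); last exact: val_inj.
Qed.

End Tensor.

(** * Holomorphic maps between bundles *)

Section BundleMaps.
Variables (R : realType) (X : riemannSurface R).
Local Notation C := (R[i]).

Lemma hol_mx_at_near_eq m n (A B : X -> 'M[C]_(m, n)) x :
  (\forall y \near x, A y = B y) -> hol_mx_at A x -> hol_mx_at B x.
Proof.
by move=> AB hA k l; apply: hol_at_near_eq (hA k l); apply: filterS AB => y ->.
Qed.

Lemma hol_mx_atM m n p (A : X -> 'M[C]_(m, n)) (B : X -> 'M[C]_(n, p)) x :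
  hol_mx_at A x -> hol_mx_at B x -> hol_mx_at (fun y => A y *m B y) x.
Proof. exact: (entrywiseM (hol_at_ring x)). Qed.

Lemma near_tr_dom n (G : bundle X n) (i : tr_idx G) x :
  tr_dom i x -> \forall y \near x, tr_dom i y.
Proof. by move=> ix; apply: open_nbhs_nbhs; split=> //; exact: tr_dom_open. Qed.

Lemma tr_line_neq0 (N : bundle X 1) (j : tr_idx N) x :
  tr_dom j x -> tr j x ord0 ord0 != 0.
Proof. by move=> /tr_unit; rewrite unitmxE det_mx11 unitfE. Qed.

Definition hol_hom_at m n (G : bundle X m) (H : bundle X n)
    (A : X -> 'M[C]_(n, m)) x :=
  forall (i : tr_idx G) (j : tr_idx H), tr_dom i x -> tr_dom j x ->
    hol_mx_at (fun y => tr j y *m A y *m invmx (tr i y)) x.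

(** Transition functions are holomorphic, so one pair of trivialisations
    suffices. *)
Lemma hol_hom_at_tr m n (G : bundle X m) (H : bundle X n) A x
    (i : tr_idx G) (j : tr_idx H) : tr_dom i x -> tr_dom j x ->
  hol_mx_at (fun y => tr j y *m A y *m invmx (tr i y)) x -> hol_hom_at G H A x.
Proof.
move=> ix jx hA i' j' i'x j'x.
have hl := tr_transition j'x jx; have hr := tr_transition ix i'x.
apply: hol_mx_at_near_eq (hol_mx_atM (hol_mx_atM hl hA) hr).
apply: filterS2 (near_tr_dom ix) (near_tr_dom jx) => y iy jy.
by rewrite !mulmxA mulmxKV ?tr_unit // mulmxKV ?tr_unit.
Qed.

Lemma hol_section_at_hom m n (G : bundle X m) (H : bundle X n) A s x :
  hol_hom_at G H A x -> hol_section_at G s x ->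
  hol_section_at H (fun y => A y *m s y) x.
Proof.
move=> hA hs j jx; have [i ix] := tr_cover G x.
apply: hol_mx_at_near_eq (hol_mx_atM (hA i j ix jx) (hs i ix)).
by apply: filterS (near_tr_dom ix) => y iy; rewrite -!mulmxA mulKmx ?tr_unit.
Qed.

Lemma hol_section_at_frame n (G : bundle X n) (i : tr_idx G) x (v : 'cV[C]_n) :
  tr_dom i x -> hol_section_at G (fun y => invmx (tr i y) *m v) x.
Proof.
move=> ix j jx.
have hv : hol_mx_at (fun=> v) x by move=> k l; exact: hol_at_cst.
apply: hol_mx_at_near_eq (hol_mx_atM (tr_transition jx ix) hv).
by near=> y; rewrite mulmxA.
Unshelve. all: by end_near. Qed.

Lemma hol_section_through n (G : bundle X n) x (v : 'cV[C]_n) :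
  exists2 s, hol_section_at G s x & s x = v.
Proof.
have [i ix] := tr_cover G x.
exists (fun y => invmx (tr i y) *m (tr i x *m v)); first exact: hol_section_at_frame.
by rewrite mulKmx ?tr_unit.
Qed.

Section Pullback.
Variables (S : bundle X 1) (p : tot X).

Lemma entrywise_base m n (A : X -> 'M[C]_(m, n)) : hol_mx_at A p.1 ->
  entrywise (fun f : tot X -> C => tot_hol_at S f p) (fun q => A q.1).
Proof.
by move=> hA k l; exact: (@tot_hol_at_base _ _ S (fun y => A y k l) p (hA k l)).
Qed.

Lemma pull_section_atP n (G : bundle X n) v : pull_section_at S G v p <->
  forall i : tr_idx G, tr_dom i p.1 ->
    entrywise (fun f => tot_hol_at S f p) (fun q => tr i q.1 *m v q).
Proof.
by split=> hv i ip k; [move=> l; rewrite (ord1 l)|]; exact: hv.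
Qed.

Lemma pull_section_at_hom m n (G : bundle X m) (H : bundle X n) A w :
  hol_hom_at G H A p.1 -> pull_section_at S G w p ->
  pull_section_at S H (fun q => A q.1 *m w q) p.
Proof.
move=> hA /pull_section_atP hw; apply/pull_section_atP => j jp k l.
have [i ip] := tr_cover G p.1.
apply: tot_hol_at_near_eq
  (entrywiseM (tot_hol_at_ring S p) (entrywise_base (hA i j ip jp)) (hw i ip) k l).
apply: tot_nearS (tot_near_tr_dom ip) => q iq.
by rewrite -!mulmxA mulKmx ?tr_unit.
Qed.

Lemma pull_section_at_frame n (G : bundle X n) (i : tr_idx G) f :
  tr_dom i p.1 -> entrywise (fun h => tot_hol_at S h p) f ->
  pull_section_at S G (fun q => invmx (tr i q.1) *m f q) p.
Proof.
move=> ip hf; apply/pull_section_atP => j jp k l.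
apply: tot_hol_at_near_eq (entrywiseM (tot_hol_at_ring S p)
  (entrywise_base (tr_transition jp ip)) hf k l).
by apply: tot_nearE => q; rewrite mulmxA.
Qed.

Lemma pull_section_at0 n (G : bundle X n) : pull_section_at S G (fun=> 0) p.
Proof.
move=> i ip k; have [c0 _ _] := tot_hol_at_ring S p.
apply: tot_hol_at_near_eq (c0 0); apply: tot_nearE => q.
by rewrite mulmx0 mxE.
Qed.

Lemma zero_on_curve_eq0 r (Th : X -> 'I_1 -> 'M[C]_r) n (G : bundle X n) u :
  tot_near S p (fun q => u q = 0) -> zero_on_curve S Th G u p.
Proof.
move=> u0 j jp; exists (fun=> 0); first exact: pull_section_at0.
by apply: tot_nearS u0 => q ->; rewrite scaler0.
Qed.

End Pullback.

Section TwistedEndomorphism.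
Variables (r : nat) (E : bundle X r).

Lemma hol_twisted_end_line (N : bundle X 1) (T : X -> 'I_1 -> 'M[C]_r) x
    (i : tr_idx E) (j : tr_idx N) : hol_twisted_end E N T ->
  tr_dom i x -> tr_dom j x ->
  hol_mx_at (fun y => tr j y ord0 ord0 *: (tr i y *m T y ord0 *m invmx (tr i y))) x.
Proof.
move=> hT ix jx; apply: hol_mx_at_near_eq (hT x i j ix jx ord0).
by near=> y; rewrite id_tensor_line.
Unshelve. all: by end_near. Qed.

Lemma hol_hom_at_twist (N : bundle X 1) (T : X -> 'I_1 -> 'M[C]_r) x :
  hol_twisted_end E N T -> hol_hom_at E (twist E N) (fun y => T y ord0) x.
Proof.
move=> hT; have [i ix] := tr_cover E x; have [j jx] := tr_cover N x.
apply: (@hol_hom_at_tr _ _ E (twist E N) _ _ i (i, j)) => //.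
apply: hol_mx_at_near_eq (hol_twisted_end_line hT ix jx).
by near=> y; rewrite /= -!scalemxAl.
Unshelve. all: by end_near. Qed.

(** The trivialisation of N removes the twist from T. *)
Lemma hol_hom_at_line_end (N : bundle X 1) (T : X -> 'I_1 -> 'M[C]_r) x
    (j : tr_idx N) : hol_twisted_end E N T -> tr_dom j x ->
  hol_hom_at E E (fun y => tr j y ord0 ord0 *: T y ord0) x.
Proof.
move=> hT jx; have [i ix] := tr_cover E x.
apply: (@hol_hom_at_tr _ _ E E _ _ i i) => //.
apply: hol_mx_at_near_eq (hol_twisted_end_line hT ix jx).
by near=> y; rewrite -scalemxAr -scalemxAl.
Unshelve. all: by end_near. Qed.

Lemma hol_hom_at_twist_end (M : bundle X 1) A x :
  hol_hom_at E E A x -> hol_hom_at (twist E M) (twist E M) A x.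
Proof.
move=> hA; have [i ix] := tr_cover E x; have [m mx] := tr_cover M x.
apply: (@hol_hom_at_tr _ _ (twist E M) (twist E M) _ _ (i, m) (i, m)) => //.
apply: hol_mx_at_near_eq (hA i i ix ix).
apply: filterS2 (near_tr_dom ix) (near_tr_dom mx) => y iy my /=.
have m0 := tr_line_neq0 my.
rewrite invmxZ; last exact: (@tr_unit _ _ _ (twist E M) (i, m) y (conj iy my)).
by rewrite -!scalemxAl -scalemxAr scalerA mulfV // scale1r.
Qed.

End TwistedEndomorphism.
End BundleMaps.

(** * The associated sheaf of the spectral curve *)

Lemma mulmx_commutator (K : pzRingType) n (A B : 'M[K]_n) (v : 'cV[K]_n) :
  (A *m B - B *m A) *m v = A *m (B *m v) - B *m (A *m v).
Proof. by rewrite mulmxBl !mulmxA. Qed.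

Lemma mulmx_delta (K : pzRingType) m n (A : 'M[K]_(m, n)) i j :
  (A *m (delta_mx j ord0 : 'cV_n)) i ord0 = A i j.
Proof. by rewrite -colE mxE. Qed.

Lemma horner_mul_adj_char_poly_mx (K : comNzRingType) m n (N : 'M[K]_(m, n))
    (B : 'M[K]_n) t i j :
  ((map_mx polyC N *m \adj (char_poly_mx B)) i j).[t] =
  (N *m \adj (t%:M - B)) i j.
Proof.
rewrite mxE horner_sum mxE; apply: eq_bigr => k _.
by rewrite mxE hornerCM horner_adj_char_poly_mx.
Qed.

Lemma scale_mulmxN (K : comNzRingType) m n (Q : 'M[K]_(m, n)) (a b : K) (e : 'cV[K]_n) :
  (a * b) *: (Q *m (- e)) = b *: (Q *m (- a *: e)).
Proof. by rewrite mulrC -scalerA scaleNr !mulmxN -scalemxAr !scalerN. Qed.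

(** The identity A adj(A) = det A for A = tau - c P T P^-1, transported by P and
    divided by c: in a trivialisation P of E and c of S, it reads
    (Theta - t) adj(t - Theta) e = - chi(t) e. *)
Lemma adjugate_eigen (K : fieldType) n (P T : 'M[K]_n) (c t tau : K) (e : 'cV[K]_n)
    (A := tau%:M - c *: (P *m T *m invmx P)) :
  c != 0 -> P \in unitmx -> c * t = tau ->
  T *m (invmx P *m (\adj A *m e)) - t *: (invmx P *m (\adj A *m e)) =
  \det A *: (invmx (c *: P) *m (- e)).
Proof.
move=> c0 uP tauE; rewrite -mul_scalar_mx -mulmxBl mulmxA.
have -> : (T - t%:M) *m invmx P = - (invmx (c *: P) *m A).
  rewrite /A -tauE mulmxBr mul_mx_scalar invmxZ; last first.
    by rewrite unitmxE detZ unitrM unitrX ?unitfE //; rewrite -unitfE.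
  rewrite -scalemxAl scalerA -scalemxAr scalerA mulVf // scale1r.
  by rewrite mulrAC mulfV // mul1r !mulmxA mulVmx // mul1mx mulmxBl mul_scalar_mx opprB.
by rewrite mulNmx mulmxA -(mulmxA _ A) mul_mx_adj mul_mx_scalar scalemxAl mulmxN.
Qed.

Section SpectralSheaf.
Variables (R : realType) (X : riemannSurface R) (S L : bundle X 1).
Variables (r : nat) (E : bundle X r) (Th Th' : X -> 'I_1 -> 'M[R[i]]_r).
Hypothesis (hTh : hol_twisted_end E S Th) (hTh' : hol_twisted_end E L Th').
Local Notation C := (R[i]).

Lemma zero_on_curve_hom m n (G : bundle X m) (H : bundle X n) A u (p : tot X) :
  hol_hom_at G H A p.1 -> zero_on_curve S Th G u p ->
  zero_on_curve S Th H (fun q => A q.1 *m u q) p.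
Proof.
move=> hA hu j jp; have [w hw uw] := hu j jp.
exists (fun q => A q.1 *m w q); first exact: (pull_section_at_hom hA hw).
by apply: tot_nearS uw => q ->; rewrite -scalemxAr.
Qed.

Lemma zero_on_curve_ext n (G : bundle X n) u v (p : tot X) :
  (forall q, u q = v q) -> zero_on_curve S Th G u p -> zero_on_curve S Th G v p.
Proof. by move=> /funext ->. Qed.

(** With c the trivialisation of L, the section Theta' v of F (x) L is the
    tensor product of c Theta' v, which is killed by Theta - t because c Theta'
    commutes with Theta, and of the frame 1 / c. *)
Lemma spectral_sheaf_twist_commute (p : tot X) v :
  (forall x, Th x ord0 *m Th' x ord0 = Th' x ord0 *m Th x ord0) ->
  spectral_sheaf S E Th v p ->
  spectral_sheaf_twist S E Th L (fun q => Th' q.1 ord0 *m v q) p.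
Proof.
move=> comm [hv Fv]; have [l lp] := tr_cover L p.1.
split; first exact: (pull_section_at_hom (hol_hom_at_twist hTh')).
pose c y := tr l y ord0 ord0.
have hA : hol_hom_at E E (fun y => c y *: Th' y ord0) p.1.
  exact: hol_hom_at_line_end.
exists 1%N, (fun _ q => (c q.1 *: Th' q.1 ord0) *m v q),
  (fun _ q => invmx (tr l q.1) *m const_mx 1); split.
  move=> _; split.
    split; first exact: (pull_section_at_hom hA hv).
    have := zero_on_curve_hom (hol_hom_at_twist_end (M := S) hA) Fv.
    apply: zero_on_curve_ext => q.
    by rewrite mulmxBr -scalemxAr -!scalemxAl -scalemxAr !mulmxA comm.
  apply: pull_section_at_frame => //.
  exact: (entrywise_cst (tot_hol_at_ring S p)).
apply: zero_on_curve_eq0; apply: tot_nearS (tot_near_tr_dom lp) => q lq.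
rewrite big_ord1 -scalemxAl scalerA.
have -> : (invmx (tr l q.1) *m (const_mx 1 : 'cV[C]_1)) ord0 ord0 * c q.1 = 1.
  have := congr1 (fun B : 'M[C]_1 => B ord0 ord0) (mulVmx (tr_unit lq)).
  by rewrite !mxE !big_ord1 mxE eqxx mulr1.
by rewrite scale1r subrr.
Qed.

Section LocalEigensection.
Variables (p : tot X) (i : tr_idx E) (j : tr_idx S).
Hypotheses (ip : tr_dom i p.1) (jp : tr_dom j p.1).

Let B (y : X) : 'M[C]_r :=
  tr j y ord0 ord0 *: (tr i y *m Th y ord0 *m invmx (tr i y)).

(** The section adj(t - Theta) e of E, rescaled by the trivialisation of S so that
    its entries are polynomials in the fibre coordinate. *)
Definition adjugate_section (e : 'cV[C]_r) (q : tot X) : 'cV[C]_r :=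
  invmx (tr i q.1) *m (\adj ((tot_coord j q)%:M - B q.1) *m e).

Lemma spectral_eqE q : tr_dom i q.1 ->
  spectral_eq Th j q = \det ((tot_coord j q)%:M - B q.1).
Proof.
move=> iq; rewrite /spectral_eq horner_char_poly.
have -> : (tot_coord j q)%:M - B q.1 = tr i q.1 *m
    ((tot_coord j q)%:M - tr j q.1 ord0 ord0 *: Th q.1 ord0) *m invmx (tr i q.1).
  rewrite mulmxBr mulmxBl mul_mx_scalar -!scalemxAr -!scalemxAl mulmxV ?tr_unit //.
  by rewrite scalemx1.
by rewrite !det_mulmx mulrAC -det_mulmx mulmxV ?tr_unit // det1 mul1r.
Qed.

(** The equation of the curve is a section of the r-th power of S. *)
Lemma spectral_eq_change (j' : tr_idx S) q : tr_dom j q.1 -> tr_dom j' q.1 ->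
  spectral_eq Th j q = (tr j q.1 *m invmx (tr j' q.1)) ord0 ord0 ^+ r
    * spectral_eq Th j' q.
Proof.
move=> jq j'q; rewrite /spectral_eq [LHS]horner_char_poly [X in _ * X]horner_char_poly.
set c := (_ *m _) ord0 ord0; rewrite -[RHS]detZ.
have cE (M : 'cV[C]_1) : (tr j q.1 *m M) ord0 ord0 = c * (tr j' q.1 *m M) ord0 ord0.
  have -> : tr j q.1 *m M = (tr j q.1 *m invmx (tr j' q.1)) *m (tr j' q.1 *m M).
    by rewrite -!mulmxA mulKmx ?tr_unit.
  by rewrite [LHS]mxE big_ord1.
congr (\det _); rewrite scalerBr scale_scalar_mx /tot_coord -cE; congr (_ - _).
by rewrite scalerA; congr (_ *: _); have := cE 1%:M; rewrite !mulmx1.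
Qed.

Lemma adjugate_section_spectral_sheaf e :
  spectral_sheaf S E Th (adjugate_section e) p.
Proof.
have ringP := tot_hol_at_ring S p.
split.
  apply: pull_section_at_frame => //; apply: (entrywiseM ringP); last first.
    exact: entrywise_cst.
  apply: (entrywise_adj ringP); apply: (entrywiseD ringP).
    by apply: (entrywise_scalar ringP); exact: tot_hol_at_coord.
  apply: (entrywiseN ringP).
  exact: (@entrywise_base _ _ S p _ _ B (hol_twisted_end_line hTh ip jp)).
move=> j' j'p.
(* the r-th power of the transition function turns the equation of the curve
   in the trivialisation j, which the computation produces, into that in j' *)
pose f (q : tot X) : 'cV[C]_r := - ((tr j q.1 *m invmx (tr j' q.1)) ord0 ord0 ^+ r) *: e.
exists (fun q => invmx (tr j q.1 ord0 ord0 *: tr i q.1) *m f q).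
  apply: (@pull_section_at_frame _ _ S p _ (twist E S) (i, j)) => //.
  apply: (entrywiseZ ringP); last exact: entrywise_cst.
  apply: (function_ringN ringP).
  rewrite (_ : (fun t => _) = (fun t : tot X => \prod_(k < r)
      (tr j t.1 *m invmx (tr j' t.1)) ord0 ord0)); last first.
    by apply/funext => t; rewrite prodr_const card_ord.
  apply: (function_ring_prod ringP) => _ _.
  exact: (@entrywise_base _ _ S p _ _ (fun y => tr j y *m invmx (tr j' y))
    (tr_transition jp j'p)).
have jj'p : tot_near S p (fun q => tr_dom j q.1 /\ tr_dom j' q.1).
  by apply: tot_nearS2 (tot_near_tr_dom jp) (tot_near_tr_dom j'p).
apply: tot_nearS2 (tot_near_tr_dom ip) jj'p => q iq [jq j'q].
have tauE : tr j q.1 ord0 ord0 * q.2 ord0 ord0 = tot_coord j q.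
  by rewrite /tot_coord mxE big_ord1.
apply: etrans (adjugate_eigen _ _ (tr_line_neq0 jq) (tr_unit iq) tauE) _.
have detE := etrans (esym (spectral_eqE iq)) (spectral_eq_change jq j'q).
apply: etrans (congr1 (fun d => d *: _) detE) _.
exact: scale_mulmxN.
Qed.

Lemma spectral_curveE q : tr_dom j q.1 ->
  spectral_eq Th j q = 0 -> spectral_curve Th q.
Proof.
move=> jq; rewrite /spectral_eq /spectral_curve /= /root !horner_char_poly.
have -> : tot_coord j q = tr j q.1 ord0 ord0 * q.2 ord0 ord0.
  by rewrite /tot_coord mxE big_ord1.
rewrite -scale_scalar_mx -scalerBr detZ => /eqP; rewrite mulf_eq0 expf_eq0.
by rewrite (negPf (tr_line_neq0 jq)) andbF.
Qed.

End LocalEigensection.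

(** In the fibre over x, the entries of the matrix N adj(t - B), with B and N
    the expressions of Theta and [Theta', Theta] in trivialisations, are
    polynomials in the fibre coordinate t that are locally divisible by the
    characteristic polynomial of B at each of its roots. *)
Lemma commute_of_zero_on_curve :
  (forall (p : tot X) v, spectral_curve Th p -> spectral_sheaf S E Th v p ->
     zero_on_curve S Th (twist E (twist S L))
       (fun q => Th' q.1 ord0 *m (Th q.1 ord0 *m v q)
                 - Th q.1 ord0 *m (Th' q.1 ord0 *m v q)) p) ->
  forall x, Th' x ord0 *m Th x ord0 = Th x ord0 *m Th' x ord0.
Proof.
move=> zero x.
have [i ix] := tr_cover E x; have [j jx] := tr_cover S x.
have [l lx] := tr_cover L x.
pose G := twist E (twist S L); pose m : tr_idx G := (i, (j, l)).
have mx : tr_dom m x by [].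
pose B := tr j x ord0 ord0 *: (tr i x *m Th x ord0 *m invmx (tr i x)).
pose M := Th' x ord0 *m Th x ord0 - Th x ord0 *m Th' x ord0.
apply/eqP; rewrite -subr_eq0 -/M; apply/eqP.
suff N0 : tr m x *m M *m invmx (tr i x) = 0.
  have := congr1 (fun N => invmx (tr m x) *m (N *m tr i x)) N0.
  by rewrite mul0mx mulmx0 -!mulmxA mulVmx ?tr_unit // mulmx1 mulKmx ?tr_unit.
set N := _ *m invmx _; apply: (mul_adj_char_poly_mx_eq0 (B := B)).
apply/matrixP => a b; rewrite [RHS]mxE.
apply: (@poly_eq0_of_local_quotients _ _ (char_poly B)).
  rewrite size_char_poly ltnS mxE; apply: (leq_trans (size_sum _ _ _)).
  apply/bigmax_leqP => k _; rewrite mxE mul_polyC.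
  by apply: (leq_trans (size_scale_leq _ _)); exact: size_adj_char_poly_mx.
move=> t0 t0_root.
pose p : tot X := (x, invmx (tr j x) *m const_mx t0).
have pE : tot_coord j p = t0 by exact: tot_coord_fiber.
have chiE t : spectral_eq Th j (x, invmx (tr j x) *m const_mx t) = (char_poly B).[t].
  by rewrite (@spectral_eqE i j (x, _) ix) horner_char_poly tot_coord_fiber.
have curve_p : spectral_curve Th p.
  by apply: (@spectral_curveE j p jx); rewrite chiE; exact/rootP.
pose e : 'cV[C]_r := delta_mx b ord0.
have [w hw] := zero _ _ curve_p (adjugate_section_spectral_sheaf (p := p) ix jx e) j jx.
move=> /(tot_near_fiber (p := p) (j := j) jx) /= uw.
have [w0 w0c ww0] := tot_hol_at_fiber (p := p) (j := j) jx (hw m mx a).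
rewrite pE in uw ww0 w0c; exists w0 => //; apply: nbhs_dnbhs.
apply: filterS2 uw ww0 => t; rewrite chiE => uw <-.
have {}uw := congr1 (mulmx (tr m x)) (etrans (mulmx_commutator _ _ _) uw).
rewrite -/M /adjugate_section /= tot_coord_fiber // -/B in uw.
rewrite horner_mul_adj_char_poly_mx -mulmx_delta /N.
rewrite -!mulmxA uw -scalemxAr mxE.
by [].
Qed.
End SpectralSheaf.

(** * Lifting through the torsion sequence *)

Lemma col_mx_fst (K : Type) n (A B : 'M[K]_(1, n)) j :
  (col_mx A B : 'M[K]_(2, n)) 0 j = A ord0 j.
Proof. by rewrite -(col_mxEu A B); congr (col_mx A B _ _); exact: val_inj. Qed.

Lemma col_mx_snd (K : Type) n (A B : 'M[K]_(1, n)) j :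
  (col_mx A B : 'M[K]_(2, n)) 1 j = B ord0 j.
Proof. by rewrite -(col_mxEd A B); congr (col_mx A B _ _); exact: val_inj. Qed.

Section TorsionSequence.
Variables (R : realType) (X : riemannSurface R).
Local Notation C := (R[i]).
Variables (V : bundle X 2) (S L : bundle X 1) (Q : torsion_sequence V S L).

Lemma ts_Phi_hol_at x : hol_hom_at V (dsum S L) (ts_Phi Q) x.
Proof. by move=> i j; exact: ts_Phi_hol. Qed.

(** Exactness gives xi (Phi v) = 0 at x for every germ v of section of V, and
    the values v x of such germs fill the fibre. *)
Lemma ts_xi_Phi x : ts_D Q x -> ts_xi Q x *m ts_Phi Q x = 0.
Proof.
move=> Dx; apply/matrixP => a b.
have [v hv vx] := hol_section_through V x (delta_mx b ord0).
have hs := hol_section_at_hom (ts_Phi_hol_at (x := x)) hv.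
have /(ts_exact_mid Q hs).2/(_ Dx) xi0 : exists2 u, hol_section_at V u x &
    \forall y \near x, ts_Phi Q y *m u y = ts_Phi Q y *m v y.
  by exists v => //; exact: nearW.
by rewrite -mulmx_delta -vx -mulmxA xi0 !mxE.
Qed.

(** Outside D every germ of section of S (+) L lifts to V, so Phi is onto on
    fibres, and the ranks are equal. *)
Lemma ts_Phi_unit x : ~ ts_D Q x -> (ts_Phi Q x : 'M[C]_2) \in unitmx.
Proof.
move=> nDx.
have col k : {v : 'cV[C]_2 | ts_Phi Q x *m v = delta_mx k ord0}.
  apply: cid; have [s hs sx] := hol_section_through (dsum S L) x (delta_mx k ord0).
  have [|v _ vs] := (ts_exact_mid Q hs).1; first by move/nDx.
  by exists (v x); rewrite -sx; exact: (nbhs_singleton vs).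
apply: (mulmx1_unit (B := \matrix_(a, k) sval (col k) a ord0) _).1.
apply/matrixP => a b; rewrite -mulmx_delta -mulmxA.
have -> : (\matrix_(a, k) sval (col k) a ord0) *m delta_mx b ord0 = sval (col b).
  by apply/matrixP => c d; rewrite (ord1 d) mulmx_delta mxE.
by rewrite (svalP (col b)) !mxE andbT.
Qed.

Lemma near_ts_Phi_unit x : \forall y \near x, y != x -> (ts_Phi Q y : 'M[C]_2) \in unitmx.
Proof.
have cD : closed (ts_D Q `\ x).
  apply: (accessible_finite_set_closed.1 (hausdorff_accessible (@rs_hausdorff _ X))).
  exact/finite_setD/ts_D_finite.
have : \forall y \near x, (~` (ts_D Q `\ x)) y.
  by apply: open_nbhs_nbhs; split; [exact: closed_openC|move=> -[_ []]].
apply: filterS => y nDy yx; apply: ts_Phi_unit => Dy; apply: nDy; split => //.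
exact/eqP.
Qed.

Variables (r : nat) (E : bundle X r).

Lemma xi_sum_eq0 (Th Th' : X -> 'I_1 -> 'M[C]_r) (th : X -> 'I_2 -> 'M[C]_r) x :
  Th x = id_tensor (ts_rho1 Q x) (th x) -> Th' x = id_tensor (ts_rho2 Q x) (th x) ->
  ts_D Q x ->
  ts_xi1 Q x ord0 ord0 *: Th x ord0 + ts_xi2 Q x ord0 ord0 *: Th' x ord0 = 0.
Proof.
rewrite /ts_rho1 /ts_rho2 /ts_xi1 /ts_xi2 => -> -> Dx.
rewrite /id_tensor !scaler_sumr -big_split big1 //= => l _.
rewrite !scalerA -scalerDl.
have e := congr1 (fun M : 'M[C]_(1, 2) => M ord0 l) (ts_xi_Phi Dx).
rewrite -[ts_xi Q x]hsubmxK -[ts_Phi Q x]vsubmxK mul_row_col !mxE !big_ord1 in e.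
by rewrite e scale0r.
Qed.

Lemma commute_of_higgs (Th Th' : X -> 'I_1 -> 'M[C]_r) (th : X -> 'I_2 -> 'M[C]_r) x :
  Th x = id_tensor (ts_rho1 Q x) (th x) -> Th' x = id_tensor (ts_rho2 Q x) (th x) ->
  (forall k l, wedge_square (th x) k l = 0) ->
  Th x ord0 *m Th' x ord0 = Th' x ord0 *m Th x ord0.
Proof.
move=> -> -> wedge0; apply/eqP; rewrite -subr_eq0; apply/eqP.
rewrite /ts_rho1 /ts_rho2 usubmx_id_tensor dsubmx_id_tensor id_tensor_commutator.
have := wedge0 0 1; rewrite wedge_squareE /ext2_basis !mxE /= subr0 scale1r => ->.
by rewrite scaler0.
Qed.

Variables (Th Th' : X -> 'I_1 -> 'M[C]_r).
Hypotheses (hTh : hol_twisted_end E S Th) (hTh' : hol_twisted_end E L Th').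
Hypothesis xi0 : forall x, ts_D Q x ->
  ts_xi1 Q x ord0 ord0 *: Th x ord0 + ts_xi2 Q x ord0 ord0 *: Th' x ord0 = 0.

Definition lifts (th : 'I_2 -> 'M[C]_r) x :=
  Th x = id_tensor (ts_rho1 Q x) th /\ Th' x = id_tensor (ts_rho2 Q x) th.

Lemma lifts_unique th th' x : (ts_Phi Q x : 'M[C]_2) \in unitmx ->
  lifts th x -> lifts th' x -> th = th'.
Proof.
move=> uPhi [h1 h2] [h1' h2'].
rewrite -(id_tensor1 th) -(id_tensor1 th') -(mulVmx uPhi) !id_tensorM.
congr id_tensor; apply: tensor_pairP.
  by rewrite -!(usubmx_id_tensor _ _ ord0) -/(ts_rho1 Q x) -h1 -h1'.
by rewrite -!(dsubmx_id_tensor _ _ ord0) -/(ts_rho2 Q x) -h2 -h2'.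
Qed.

Definition hol_twisted_end_at n (N : bundle X n) (T : X -> 'I_n -> 'M[C]_r) x :=
  forall (i : tr_idx E) (j : tr_idx N), tr_dom i x -> tr_dom j x ->
    forall k, hol_mx_at (fun y =>
      id_tensor (tr j y) (fun l => tr i y *m T y l *m invmx (tr i y)) k) x.

(** Reduces holomorphy of T to one trivialisation of E, where T is a matrix of
    sections of N: exactness can only be applied to sections, one entry at a
    time. *)
Lemma hol_twisted_end_at_tr n (N : bundle X n) (T : X -> 'I_n -> 'M[C]_r) x
    (i : tr_idx E) : tr_dom i x ->
  (forall a b, hol_section_at N
     (fun y => \col_l (tr i y *m T y l *m invmx (tr i y)) a b) x) ->
  hol_twisted_end_at N T x.
Proof.
move=> ix hT i' j i'x jx k.
have hk : hol_mx_at (fun y => id_tensor (tr j y)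
    (fun l => tr i y *m T y l *m invmx (tr i y)) k) x.
  move=> a b; apply: hol_at_near_eq (hT a b j jx k ord0); apply: nearW => y.
  rewrite /id_tensor summxE mxE; by apply: eq_bigr => l _; rewrite !mxE.
have hl := tr_transition i'x ix; have hr := tr_transition ix i'x.
apply: hol_mx_at_near_eq (hol_mx_atM (hol_mx_atM hl hk) hr).
apply: filterS (near_tr_dom ix) => y iy.
rewrite !id_tensor_conj -!mulmxA; congr (_ *m _).
by rewrite mulKmx ?tr_unit // mulKmx ?tr_unit.
Qed.

(** In a trivialisation of E, the (a, b) entries of Theta and Theta' form a
    section of S (+) L which xi kills over D, so it comes from a section of
    V. *)
Lemma local_lift x : exists2 th : X -> 'I_2 -> 'M[C]_r,
  hol_twisted_end_at V th x & \forall y \near x, lifts (th y) y.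
Proof.
have [i ix] := tr_cover E x.
pose T y := tr i y *m Th y ord0 *m invmx (tr i y).
pose T' y := tr i y *m Th' y ord0 *m invmx (tr i y).
pose s a b y : 'cV[C]_(1 + 1) := col_mx (T y a b)%:M (T' y a b)%:M.
have hs a b : hol_section_at (dsum S L) (s a b) x.
  move=> [j l] [jx lx].
  have := hol_twisted_end_line hTh ix jx; have := hol_twisted_end_line hTh' ix lx.
  move=> /(_ a b) hl /(_ a b) hj k z; rewrite (ord1 z).
  case: (split_ordP k) => k' ->; rewrite (ord1 k').
    apply: hol_at_near_eq hj; apply: nearW => y.
    by rewrite /s /= mul_block_col !mul0mx addr0 col_mxEu !mxE big_ord1 !mxE.
  apply: hol_at_near_eq hl; apply: nearW => y.
  by rewrite /s /= mul_block_col !mul0mx add0r col_mxEd !mxE big_ord1 !mxE.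
have lift_entry ab : exists v : X -> 'cV[C]_2, hol_section_at V v x /\
    \forall y \near x, ts_Phi Q y *m v y = s ab.1 ab.2 y.
  have [|v hv vs] := (ts_exact_mid Q (hs ab.1 ab.2)).1; last by exists v.
  move=> Dx; have e : ts_xi1 Q x ord0 ord0 * T x ab.1 ab.2
      + ts_xi2 Q x ord0 ord0 * T' x ab.1 ab.2 = 0.
    have := congr1 (fun M : 'M[C]_r => (tr i x *m M *m invmx (tr i x)) ab.1 ab.2)
      (xi0 Dx).
    rewrite mulmxDr mulmxDl -!scalemxAr -!scalemxAl mulmx0 mul0mx.
    by rewrite [LHS]mxE [X in X + _]mxE [X in _ + X]mxE [RHS]mxE.
  rewrite -[ts_xi Q x]hsubmxK mul_row_col !mul_mx_scalar.
  apply/matrixP => u w; rewrite (ord1 u) (ord1 w).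
  rewrite [LHS]mxE [X in X + _]mxE [X in _ + X]mxE [RHS]mxE.
  by rewrite mulrC [X in _ + X]mulrC; exact: e.
have [v /all_and2 [hv vs]] := choice lift_entry.
pose th y l := invmx (tr i y) *m (\matrix_(a, b) v (a, b) y l ord0) *m tr i y.
exists th.
  apply: (@hol_twisted_end_at_tr _ _ _ _ i) => // a b j jx.
  apply: hol_mx_at_near_eq (hv (a, b) j jx).
  apply: filterS (near_tr_dom ix) => y iy; congr (_ *m _).
  apply/matrixP => l z; rewrite (ord1 z) [RHS]mxE /th.
  by rewrite !mulmxA mulmxV ?tr_unit // mul1mx mulmxK ?tr_unit // mxE.
have : \forall y \near x, forall ab, ts_Phi Q y *m v ab y = s ab.1 ab.2 y.
  by apply: filter_forall => ab; exact: vs.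
apply: filterS2 (near_tr_dom ix) => y iy vy.
have conjE (M N : 'M[C]_r) : M = tr i y *m N *m invmx (tr i y) ->
    invmx (tr i y) *m M *m tr i y = N.
  by move=> ->; rewrite !mulmxA mulVmx ?tr_unit // mul1mx mulmxKV ?tr_unit.
have entry k : id_tensor (ts_Phi Q y)
    (fun l => \matrix_(a, b) v (a, b) y l ord0) k =
    \matrix_(a, b) s a b y k ord0.
  apply/matrixP => a b; rewrite /id_tensor summxE mxE -(vy (a, b)) mxE.
  by apply: eq_bigr => l _; rewrite !mxE.
split; apply/funext => k; rewrite (ord1 k).
  rewrite usubmx_id_tensor id_tensor_conj entry; apply/esym/conjE.
  apply/matrixP => a b; rewrite [LHS]mxE.
  by rewrite col_mx_fst mxE.
rewrite dsubmx_id_tensor id_tensor_conj entry; apply/esym/conjE.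
apply/matrixP => a b; rewrite [LHS]mxE.
by rewrite col_mx_snd mxE.
Qed.

Lemma hol_twisted_end_at_near_eq (T T' : X -> 'I_2 -> 'M[C]_r) x :
  (\forall y \near x, T y = T' y) ->
  hol_twisted_end_at V T x -> hol_twisted_end_at V T' x.
Proof.
move=> TT hT i j ix jx k; apply: hol_mx_at_near_eq (hT i j ix jx k).
by apply: filterS TT => y ->.
Qed.

(** A lift near x, chosen for each x, is evaluated at x only.  At the points y
    near x other than x, Phi is injective, so the lifts chosen at x and at y
    have the same value at y. *)
Lemma global_lift : exists2 th : X -> 'I_2 -> 'M[C]_r,
  hol_twisted_end E V th & forall x, lifts (th x) x.
Proof.
have /choice[th /all_and2[hth lth]] : forall x, exists th : X -> 'I_2 -> 'M[C]_r,
    hol_twisted_end_at V th x /\ \forall y \near x, lifts (th y) y.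
  by move=> x; have [th] := local_lift x; exists th.
exists (fun x => th x x) => x; last exact: (nbhs_singleton (lth x)).
apply: (@hol_twisted_end_at_near_eq (th x)) => //.
apply: filterS2 (lth x) (near_ts_Phi_unit x) => y ly uy.
have [-> //|/uy Phi_unit] := eqVneq y x.
exact: lifts_unique ly (nbhs_singleton (lth y)).
Qed.

Lemma wedge_square_eq0 (th : X -> 'I_2 -> 'M[C]_r) :
  hol_twisted_end E V th -> (forall x, lifts (th x) x) ->
  (forall x, Th x ord0 *m Th' x ord0 = Th' x ord0 *m Th x ord0) ->
  forall x k l, wedge_square (th x) k l = 0.
Proof.
move=> hth lth comm x k l; rewrite wedge_squareE.
suff -> : th x 0 *m th x 1 - th x 1 *m th x 0 = 0 by rewrite scaler0.
have [i ix] := tr_cover E x; have [j jx] := tr_cover V x.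
pose T y := id_tensor (tr j y) (fun l => tr i y *m th y l *m invmx (tr i y)).
pose K y := T y 0 *m T y 1 - T y 1 *m T y 0.
have hK : hol_mx_at K x.
  have hT := hth x i j ix jx.
  apply: (entrywiseD (hol_at_ring x)); first exact: (hol_mx_atM (hT 0) (hT 1)).
  by apply: (entrywiseN (hol_at_ring x)); exact: (hol_mx_atM (hT 1) (hT 0)).
have KE y : tr_dom i y -> K y = \det (tr j y) *:
    (tr i y *m (th y 0 *m th y 1 - th y 1 *m th y 0) *m invmx (tr i y)).
  move=> iy; rewrite /K /T id_tensor_commutator; congr (_ *: _).
  rewrite mulmxBr mulmxBl; congr (_ - _);
  by rewrite -!mulmxA mulKmx ?tr_unit.
have Kx0 : K x = 0.
  apply/matrixP => a b; rewrite [RHS]mxE; apply: hol_at_dnbhs_eq0 (hK a b) _.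
  have ux : \forall y \near x, y != x -> (ts_Phi Q y : 'M[C]_2) \in unitmx.
    exact: near_ts_Phi_unit.
  apply: filterS2 ux (near_tr_dom ix) => y uy iy /= yx.
  rewrite KE // (_ : th y 0 *m th y 1 - _ = 0).
    by rewrite mulmx0 mul0mx scaler0 mxE.
  have := comm y; have [-> ->] := lth y.
  move=> /eqP; rewrite -subr_eq0 usubmx_id_tensor dsubmx_id_tensor.
  rewrite id_tensor_commutator scalemx_eq0 => /orP[|/eqP //].
  by have := uy yx; rewrite unitmxE unitfE => /negPf ->.
have := KE x ix; rewrite Kx0 => /esym/eqP; rewrite scalemx_eq0.
have := tr_unit jx; rewrite unitmxE unitfE => /negPf -> /= /eqP K0.
have := congr1 (fun M => invmx (tr i x) *m (M *m tr i x)) K0.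
by rewrite mul0mx mulmx0 -!mulmxA mulVmx ?tr_unit // mulmx1 mulKmx ?tr_unit.
Qed.

End TorsionSequence.

Theorem corollary3p5 (R : realType) (X : riemannSurface R)
    (V : bundle X 2) (S L : bundle X 1) (Q : torsion_sequence V S L)
    (r : nat) (E : bundle X r)
    (Th Th' : X -> 'I_1 -> 'M[R[i]]_r)
    (hTh : hol_twisted_end E S Th) (hTh' : hol_twisted_end E L Th') :
  (exists th : X -> 'I_2 -> 'M[R[i]]_r,
     [/\ twisted_higgs E V th,
         forall x, Th x = id_tensor (ts_rho1 Q x) (th x) &
         forall x, Th' x = id_tensor (ts_rho2 Q x) (th x)])
  <->
  [/\ forall (p : tot X) (v : tot X -> 'cV[R[i]]_r),
        spectral_curve Th p -> spectral_sheaf S E Th v p ->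
        spectral_sheaf_twist S E Th L (fun q => Th' q.1 ord0 *m v q) p,
      forall (p : tot X) (v : tot X -> 'cV[R[i]]_r),
        spectral_curve Th p -> spectral_sheaf S E Th v p ->
        zero_on_curve S Th (twist E (twist S L))
          (fun q => Th' q.1 ord0 *m (Th q.1 ord0 *m v q)
                    - Th q.1 ord0 *m (Th' q.1 ord0 *m v q)) p &
      forall (x : X) (s : 'cV[R[i]]_1), ts_D Q x ->
        spectral_curve Th (x, s) ->
        forall v : 'cV[R[i]]_r, gen_eigen (Th x ord0) (s ord0 ord0) v ->
          ts_xi1 Q x ord0 ord0 *: (Th x ord0 *m v)
          + ts_xi2 Q x ord0 ord0 *: (Th' x ord0 *m v) = 0].
Proof.
split=> [[th [[hth wedge0] h1 h2]]|[_ zero eig]].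
  have comm x := commute_of_higgs (h1 x) (h2 x) (wedge0 x).
  split.
  - by move=> p v _; exact: spectral_sheaf_twist_commute.
  - move=> p v _ _; apply: zero_on_curve_eq0; apply: tot_nearE => q.
    by rewrite -mulmx_commutator comm subrr mul0mx.
  - move=> x s Dx _ v _.
    by rewrite !scalemxAl -mulmxDl (xi_sum_eq0 (h1 x) (h2 x) Dx) mul0mx.
have comm x := esym (commute_of_zero_on_curve hTh zero x).
have xi0 x : ts_D Q x ->
    ts_xi1 Q x ord0 ord0 *: Th x ord0 + ts_xi2 Q x ord0 ord0 *: Th' x ord0 = 0.
  move=> Dx; apply: (generalized_eigenvectors_span (A := Th x ord0)) => a v ra va.
  have aE : (const_mx a : 'cV[R[i]]_1) ord0 ord0 = a by rewrite mxE.
  have := eig x (const_mx a) Dx; rewrite /spectral_curve /= aE => /(_ ra v va).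
  by rewrite mulmxDl -!scalemxAl.
have [th hth lth] := global_lift hTh hTh' xi0.
exists th; split; [split|by move=> x; case: (lth x)|by move=> x; case: (lth x)].
  exact: hth.
exact: (wedge_square_eq0 hth lth comm).
Qed.
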